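(* Let $M$ be a tame paving matroid of rank $n$ on $[d]$. Then the circuit variety of $M$ has the irredundant irreducible decomposition $$V_{\mathcal{C}(M)}=\bigcup_{\mathcal{Q}}V_{M(\mathcal{Q})},$$ where the union is over all nice partitions $\mathcal{Q}$ of the set of dependent hyperplanes of $M$; that is, the equality holds, each $V_{M(\mathcal{Q})}$ is irreducible, and $V_{M(\mathcal{Q}_1)}\not\subseteq V_{M(\mathcal{Q}_2)}$ for distinct nice partitions $\mathcal{Q}_1\ne\mathcal{Q}_2$.
   Context: A matroid of rank $n$ is paving ($n$-paving) if every circuit has size $n$ or $n+1$; a dependent hyperplane is a maximal subset of size at least $n$ all of whose $n$-subsets are circuits; a paving matroid is tame if any three distinct dependent hyperplanes have empty intersection. Varieties: for a matroid $N$ on $[d]$, a realization in $\mathbb{C}^n$ is a tuple $(\gamma_1,\ldots,\gamma_d)\in(\mathbb{C}^n)^d=\mathbb{C}^{nd}$ such that $S\subseteq[d]$ is dependent in $N$ iff $(\gamma_i)_{i\in S}$ is linearly dependent; the matroid variety $V_N\subseteq\mathbb{C}^{nd}$ is the Zariski closure of the set of realizations. The circuit variety $V_{\mathcal{C}(N)}$ is the set of tuples $(\gamma_i)$ in $(\mathbb{C}^n)^d$ such that $(\gamma_i)_{i\in S}$ is linearly dependent for every dependent set $S$ of $N$. Here $n=\operatorname{rank}M$ throughout. Quasi-paving construction: for a collection $\mathcal{H}$ of subsets of $[d]$ any three of which have empty intersection, the matroid on $[d]$ whose circuits are (Type 1) the $(n-1)$-subsets contained in the intersection of two distinct members of $\mathcal{H}$,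 (Type 2) the $n$-subsets of a member of $\mathcal{H}$ containing no Type 1 set, (Type 3) the $(n+1)$-subsets containing no Type 1 or Type 2 set. For a partition $\mathcal{Q}=\{Q_1,\ldots,Q_k\}$ of the dependent hyperplanes, $M(\mathcal{Q})$ is obtained by this construction with $\mathcal{H}=\{H_1,\ldots,H_k\}$, $H_i=\bigcup_{l\in Q_i}l$. For a set $L$ of at least two dependent hyperplanes, $M^L$ is the $n$-paving matroid on $\bigcup_{l\in L}l$ whose set of dependent hyperplanes is exactly $L$. An $n$-paving matroid $N$ on a set $E$ is liftable if for every tuple $(\gamma_e)_{e\in E}$ of vectors in $\mathbb{C}^n$ spanning a hyperplane $H$ and every $q\notin H$, there are scalars $z_e$ with $(\gamma_e+z_eq)_{e\in E}\in V_{\mathcal{C}(N)}$ and the vectors $\gamma_e+z_eq$ not all contained in a common hyperplane. A partition $\mathcal{Q}=\{Q_1,\ldots,Q_k\}$ of the dependent hyperplanes of $M$ is nice if (i) $M^{Q_i}$ is not liftable for every $i$ with $|Q_i|\ge2$, and (ii) there is no $i$ and dependent hyperplane $l\notin Q_i$ with $l\subseteq\bigcup_{l'\in Q_i}l'$. *)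

(* Defs.v *)
(* finite combinatorics (finset), matrices (mxalgebra),
   multivariate polynomials (multinomials' mpoly) over C := R[i] for an
   arbitrary R : realType (any realType is isomorphic to the real numbers,
   so R[i] is the field of complex numbers). *)
From HB Require Import structures.
From mathcomp Require Import all_boot all_algebra.
From mathcomp Require Import reals complex mpoly.
Set Implicit Arguments.
Unset Strict Implicit.
Unset Printing Implicit Defensive.
Import GRing.Theory.
Local Open Scope ring_scope.

Section Matroids.
Variable d : nat.

Definition is_matroid (I : {set {set 'I_d}}) : Prop :=
  [/\ set0 \in I,
      (forall A B : {set 'I_d}, B \in I -> A \subset B -> A \in I) &
      (forall A B : {set 'I_d}, A \in I -> B \in I -> (#|A| < #|B|)%N ->
         exists2 x, x \in B :\: A & x |: A \in I)].

Definition has_rank (I : {set {set 'I_d}}) (n : nat) : Prop :=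
  (exists2 B, B \in I & #|B| = n) /\ (forall B, B \in I -> (#|B| <= n)%N).

Definition is_circuit (I : {set {set 'I_d}}) (C : {set 'I_d}) : bool :=
  (C \notin I) && [forall x in C, (C :\ x) \in I].

Definition paving (I : {set {set 'I_d}}) (n : nat) : Prop :=
  forall C, is_circuit I C -> #|C| = n \/ #|C| = n.+1.

Definition n_circ_set (I : {set {set 'I_d}}) (n : nat) (H : {set 'I_d}) : bool :=
  (n <= #|H|)%N &&
  [forall S : {set 'I_d}, ((S \subset H) && (#|S| == n)) ==> is_circuit I S].

Definition dep_hyp (I : {set {set 'I_d}}) (n : nat) (H : {set 'I_d}) : bool :=
  n_circ_set I n H &&
  [forall H' : {set 'I_d}, ((H \subset H') && n_circ_set I n H') ==> (H' == H)].

Definition dep_hyps (I : {set {set 'I_d}}) (n : nat) : {set {set 'I_d}} :=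
  [set H | dep_hyp I n H].

Definition tame (I : {set {set 'I_d}}) (n : nat) : Prop :=
  forall H1 H2 H3, H1 \in dep_hyps I n -> H2 \in dep_hyps I n -> H3 \in dep_hyps I n ->
    H1 != H2 -> H1 != H3 -> H2 != H3 -> H1 :&: H2 :&: H3 = set0.

Definition dep_of (Cs : {set {set 'I_d}}) (S : {set 'I_d}) : bool :=
  [exists C in Cs, C \subset S].

Definition qp_type1 (Hs : {set {set 'I_d}}) (n : nat) (S : {set 'I_d}) : bool :=
  (#|S|.+1 == n) &&
  [exists H1 in Hs, exists H2 in Hs, (H1 != H2) && (S \subset H1 :&: H2)].

Definition qp_type2 (Hs : {set {set 'I_d}}) (n : nat) (S : {set 'I_d}) : bool :=
  [&& #|S| == n, [exists H in Hs, S \subset H] &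
      ~~ [exists T : {set 'I_d}, (T \subset S) && qp_type1 Hs n T]].

Definition qp_type3 (Hs : {set {set 'I_d}}) (n : nat) (S : {set 'I_d}) : bool :=
  (#|S| == n.+1) &&
  ~~ [exists T : {set 'I_d}, (T \subset S) && (qp_type1 Hs n T || qp_type2 Hs n T)].

Definition qp_circuits (Hs : {set {set 'I_d}}) (n : nat) : {set {set 'I_d}} :=
  [set S : {set 'I_d} | [|| qp_type1 Hs n S, qp_type2 Hs n S | qp_type3 Hs n S]].

Definition MQ_circuits (Q : {set {set {set 'I_d}}}) (n : nat) : {set {set 'I_d}} :=
  qp_circuits [set cover Qi | Qi in Q] n.

(* M^L: the n-paving matroid on the ground set cover L whose dependent
   hyperplanes are exactly L, given by its circuits: the n-subsets of
   members of L, and the (n+1)-subsets of the ground set containing no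
   such n-subset. *)
Definition ML_circuits (L : {set {set 'I_d}}) (n : nat) : {set {set 'I_d}} :=
  [set S : {set 'I_d} | (S \subset cover L) &&
     (((#|S| == n) && [exists l in L, S \subset l]) ||
      ((#|S| == n.+1) &&
        ~~ [exists T : {set 'I_d},
              [&& T \subset S, #|T| == n & [exists l in L, T \subset l]]]))].

End Matroids.

(* Geometry: tuples (gamma_1..gamma_d) in (K^n)^d are d x n matrices  *)
(* whose i-th row is gamma_i.                                         *)
Section Varieties.
Variables (K : fieldType) (d n : nat).

Definition rowdep (A : 'M[K]_(d, n)) (S : {set 'I_d}) : Prop :=
  exists c : 'I_d -> K,
    [/\ exists2 i, i \in S & c i != 0,
        (forall i, i \notin S -> c i = 0) &
        \sum_i c i *: row i A = 0].

Definition realization (dep : {set 'I_d} -> bool) (A : 'M[K]_(d, n)) : Prop :=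
  forall S, dep S <-> rowdep A S.

Definition circuit_variety (dep : {set 'I_d} -> bool) (A : 'M[K]_(d, n)) : Prop :=
  forall S, dep S -> rowdep A S.

Definition mpeval (p : {mpoly K[d * n]}) (A : 'M[K]_(d, n)) : K :=
  p.@[fun k => mxvec A 0 k].

Definition zclosed (X : 'M[K]_(d, n) -> Prop) : Prop :=
  exists P : {mpoly K[d * n]} -> Prop,
    forall A, X A <-> (forall p, P p -> mpeval p A = 0).

Definition zclosure (X : 'M[K]_(d, n) -> Prop) (A : 'M[K]_(d, n)) : Prop :=
  forall p : {mpoly K[d * n]}, (forall B, X B -> mpeval p B = 0) -> mpeval p A = 0.

Definition irreducible (X : 'M[K]_(d, n) -> Prop) : Prop :=
  (exists A, X A) /\
  forall Z1 Z2, zclosed Z1 -> zclosed Z2 ->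
    (forall A, X A -> Z1 A \/ Z2 A) ->
    (forall A, X A -> Z1 A) \/ (forall A, X A -> Z2 A).

Definition matroid_variety (dep : {set 'I_d} -> bool) : 'M[K]_(d, n) -> Prop :=
  zclosure (realization dep).

(* linear subspaces of K^n are represented by row spaces of n x n matrices *)
Definition is_hyperplane (H : 'M[K]_n) : bool := (\rank H).+1 == n.

Definition rows_in (A : 'M[K]_(d, n)) (E : {set 'I_d}) : 'M[K]_(d, n) :=
  \matrix_(i, j) (if i \in E then A i j else 0).

(* liftability of the n-paving matroid on E with dependence predicate dep
   (only subsets of E matter; rows outside E are ignored) *)
Definition liftable (E : {set 'I_d}) (dep : {set 'I_d} -> bool) : Prop :=
  forall (A : 'M[K]_(d, n)) (H : 'M[K]_n) (q : 'rV[K]_n),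
    is_hyperplane H -> (rows_in A E == H)%MS -> ~~ (q <= H)%MS ->
    exists z : 'I_d -> K,
      (forall S : {set 'I_d}, S \subset E -> dep S ->
          rowdep (\matrix_i (row i A + z i *: q)) S) /\
      ~ (exists2 H' : 'M[K]_n, is_hyperplane H' &
           forall e, e \in E -> (row e (\matrix_i (row i A + z i *: q)) <= H')%MS).

Definition nice_partition (I : {set {set 'I_d}}) (Q : {set {set {set 'I_d}}}) : Prop :=
  [/\ partition Q (dep_hyps I n),
      (forall Qi, Qi \in Q -> (1 < #|Qi|)%N ->
         ~ liftable (cover Qi) (dep_of (ML_circuits Qi n))) &
      (forall Qi l, Qi \in Q -> l \in dep_hyps I n -> l \notin Qi ->
         ~~ (l \subset cover Qi))].

End Varieties.

(* Main.v *)
Require Import Defs.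
From HB Require Import structures.
From mathcomp Require Import all_boot all_order all_algebra.
From mathcomp Require Import boolp reals complex mpoly ring.
Set Implicit Arguments.
Unset Strict Implicit.
Unset Printing Implicit Defensive.
Import Order.TTheory GRing.Theory Num.Theory.
Local Open Scope ring_scope.

(* Every element lies on at most two dependent hyperplanes ("lines" below).  A partition of the
   lines, given by a labeling c, has an irreducible variety V_c: the closure of the image of the
   affine space of all choices of one normal vector per label and of polynomial projections of
   free vectors to the hyperplanes (at most two) of the labels through each element.
   - If no line lies in the union of a block not containing it, realizations of M(Q) lie in that
     image, and a generic point of it is a realization, so V_{M(Q)} = V_c.
   - A point of the circuit variety has a normal vector for each line; labeling the lines by
     these vectors puts the point in some V_c.  Take c with V_c maximal and then with the
     smallest total size of the unions of the blocks.  Moving a line into another block whose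
     union contains it does not shrink V_c but decreases that size.  If a block is liftable, a
     lift of a generic point tilts the common hyperplane h of the block to h + t (g_l - h), and
     the elements can follow polynomially in t; letting t tend to 0 embeds V_c in a
     strictly larger V_c'.  So c is nice.
   - If V_{M(Q1)} is contained in V_{M(Q2)}, comparing ranks shows that Q2 refines Q1.  If a block
     of Q1 is split by Q2, then every point of V_{M(Q2)} has a nontrivial infinitesimal lift on
     this block, a closed condition that passes to V_{M(Q1)}; the elements on two lines of
     the block are otherwise unconstrained in V_{M(Q1)}, hence the block is liftable. *)

(** * Polynomial functions and Zariski-open sets *)

(** Closure properties shared by polynomials in the entries of a matrix ([mpoly_fun]) and functions
    polynomial along lines ([line_poly]), so that determinants and adjugates are treated once for
    both. *)
Record function_algebra (K : comNzRingType) (X : Type) (C : (X -> K) -> Prop) : Prop :=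
  FunctionAlgebra {
    fa_ext : forall f g, (forall x, f x = g x) -> C f -> C g;
    fa_const : forall a, C (fun=> a);
    fa_add : forall f g, C f -> C g -> C (fun x => f x + g x);
    fa_mul : forall f g, C f -> C g -> C (fun x => f x * g x) }.

Section FunctionAlgebra.
Variables (K : comNzRingType) (X : Type) (C : (X -> K) -> Prop).
Hypothesis CA : function_algebra C.

Lemma fa_sum (J : Type) (s : seq J) (P : pred J) (F : J -> X -> K) :
  (forall j, P j -> C (F j)) -> C (fun x => \sum_(j <- s | P j) F j x).
Proof.
move=> CF; elim: s => [|j s IHs].
  by apply: (fa_ext CA) (fa_const CA 0) => x; rewrite big_nil.
case Pj: (P j); last by apply: (fa_ext CA) IHs => x; rewrite big_cons Pj.
by apply: (fa_ext CA) (fa_add CA (CF j Pj) IHs) => x; rewrite big_cons Pj.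
Qed.

Lemma fa_prod (J : Type) (s : seq J) (P : pred J) (F : J -> X -> K) :
  (forall j, P j -> C (F j)) -> C (fun x => \prod_(j <- s | P j) F j x).
Proof.
move=> CF; elim: s => [|j s IHs].
  by apply: (fa_ext CA) (fa_const CA 1) => x; rewrite big_nil.
case Pj: (P j); last by apply: (fa_ext CA) IHs => x; rewrite big_cons Pj.
by apply: (fa_ext CA) (fa_mul CA (CF j Pj) IHs) => x; rewrite big_cons Pj.
Qed.

Lemma fa_opp f : C f -> C (fun x => - f x).
Proof.
move=> Cf; apply: (fa_ext CA) (fa_mul CA (fa_const CA (-1)) Cf) => x.
by rewrite mulN1r.
Qed.

Lemma fa_exp f k : C f -> C (fun x => f x ^+ k).
Proof.
move=> Cf; elim: k => [|k IHk]; first exact: (fa_const CA 1).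
by apply: (fa_ext CA) (fa_mul CA Cf IHk) => x; rewrite exprS.
Qed.

Definition fa_mx m k (M : X -> 'M[K]_(m, k)) := forall i j, C (fun x => M x i j).

Lemma fa_mx_const m k (B : 'M[K]_(m, k)) : fa_mx (fun=> B).
Proof. by move=> i j; apply: fa_const. Qed.

Lemma fa_mx_add m k (M N : X -> 'M[K]_(m, k)) :
  fa_mx M -> fa_mx N -> fa_mx (fun x => M x + N x).
Proof.
move=> CM CN i j; apply: (fa_ext CA) (fa_add CA (CM i j) (CN i j)) => x.
by rewrite mxE.
Qed.

Lemma fa_mx_opp m k (M : X -> 'M[K]_(m, k)) : fa_mx M -> fa_mx (fun x => - M x).
Proof. by move=> CM i j; apply: (fa_ext CA) (fa_opp (CM i j)) => x; rewrite mxE. Qed.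

Lemma fa_mx_scale m k f (M : X -> 'M[K]_(m, k)) :
  C f -> fa_mx M -> fa_mx (fun x => f x *: M x).
Proof.
move=> Cf CM i j; apply: (fa_ext CA) (fa_mul CA Cf (CM i j)) => x.
by rewrite mxE.
Qed.

Lemma fa_mx_mul m k p (M : X -> 'M[K]_(m, k)) (N : X -> 'M[K]_(k, p)) :
  fa_mx M -> fa_mx N -> fa_mx (fun x => M x *m N x).
Proof.
move=> CM CN i j.
apply: (fa_ext CA) (fa_sum _ (fun l _ => fa_mul CA (CM i l) (CN l j))) => x.
by rewrite mxE.
Qed.

Lemma fa_mx_rowsub m k p (f : 'I_p -> 'I_m) (M : X -> 'M[K]_(m, k)) :
  fa_mx M -> fa_mx (fun x => rowsub f (M x)).
Proof. by move=> CM i j; apply: (fa_ext CA) (CM (f i) j) => x; rewrite mxE. Qed.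

Lemma fa_mx_col_mx m m' k (M : X -> 'M[K]_(m, k)) (N : X -> 'M[K]_(m', k)) :
  fa_mx M -> fa_mx N -> fa_mx (fun x => col_mx (M x) (N x)).
Proof.
move=> CM CN i j; case: (split_ordP i) => i' ->.
  by apply: (fa_ext CA) (CM i' j) => x; rewrite col_mxEu.
by apply: (fa_ext CA) (CN i' j) => x; rewrite col_mxEd.
Qed.

Lemma fa_det m (M : X -> 'M[K]_m) : fa_mx M -> C (fun x => \det (M x)).
Proof.
move=> CM; apply: fa_sum => s _.
by apply: (fa_mul CA (fa_const CA _)); apply: fa_prod => i _; apply: CM.
Qed.

Lemma fa_mpeval d n (p : {mpoly K[d * n]}) (M : X -> 'M[K]_(d, n)) :
  fa_mx M -> C (fun x => p.@[fun k => mxvec (M x) 0 k]).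
Proof.
move=> CM; pose F (x : X) := \sum_(m <- msupp p)
  p@_m * \prod_k (mxvec (M x) 0 k) ^+ m k.
apply: (fa_ext CA) (_ : C F) => [x|]; first by rewrite mevalE.
apply: fa_sum => m _; apply: (fa_mul CA (fa_const CA _)).
apply: fa_prod => k _; apply: fa_exp; case/mxvec_indexP: k => i j.
by apply: (fa_ext CA) (CM i j) => x; rewrite mxvecE.
Qed.

End FunctionAlgebra.

Definition mpoly_fun (K : fieldType) d n (f : 'M[K]_(d, n) -> K) : Prop :=
  exists p, forall A, mpeval p A = f A.

Lemma mpoly_fun_algebra (K : fieldType) d n :
  function_algebra (@mpoly_fun K d n).
Proof.
split=> [f g fg [p pf]|a|f g [p pf] [q qg]|f g [p pf] [q qg]].
- by exists p => A; rewrite pf fg.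
- by exists a%:MP => A; rewrite /mpeval mevalC.
- by exists (p + q) => A; rewrite /mpeval mevalD -/(mpeval p A) -/(mpeval q A) pf qg.
- by exists (p * q) => A; rewrite /mpeval mevalM -/(mpeval p A) -/(mpeval q A) pf qg.
Qed.

Lemma mpoly_fun_id (K : fieldType) d n : fa_mx (@mpoly_fun K d n) id.
Proof.
by move=> i j; exists 'X_(mxvec_index i j) => A; rewrite /mpeval mevalXU mxvecE.
Qed.

Section LinePolynomial.
Variables (K : numFieldType) (X : lmodType K).

(** A basis-free stand-in for polynomial functions. Density arguments only join two points at a
    time, so restrictions to lines suffice. *)
Definition line_poly (f : X -> K) : Prop :=
  forall x y, exists p : {poly K}, forall t, f (x + t *: y) = p.[t].

Lemma line_poly_algebra : function_algebra line_poly.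
Proof.
split=> [f g fg Cf x y|a x y|f g Cf Cg x y|f g Cf Cg x y].
- by have [p pf] := Cf x y; exists p => t; rewrite -fg.
- by exists a%:P => t; rewrite hornerC.
- have [[p pf] [q qg]] := (Cf x y, Cg x y).
  by exists (p + q) => t; rewrite hornerD pf qg.
- have [[p pf] [q qg]] := (Cf x y, Cg x y).
  by exists (p * q) => t; rewrite hornerM pf qg.
Qed.

Lemma line_poly_linear (f : {linear X -> K^o}) : line_poly f.
Proof.
move=> x y; exists ((f x)%:P + (f y)%:P * 'X) => t.
by rewrite linearD linearZ /= hornerD hornerM !hornerC hornerX mulrC.
Qed.

Lemma line_poly_mx_linear m k (f : {linear X -> 'M[K]_(m, k)}) : fa_mx line_poly f.
Proof.
move=> i j x y; exists ((f x i j)%:P + (f y i j)%:P * 'X) => t.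
by rewrite linearD linearZ !mxE hornerD hornerM !hornerC hornerX mulrC.
Qed.

Lemma poly_nonroot (p : {poly K}) : p != 0 -> exists t, p.[t] != 0.
Proof.
move=> p0; apply: contrapT => allr; pose s : seq K := [seq i%:R | i <- iota 0 (size p)].
have us : uniq s by rewrite map_inj_uniq ?iota_uniq // => i j /eqP; rewrite eqr_nat => /eqP.
have rs : all (root p) s.
  apply/allP => t _; apply/eqP/eqP/negP => pt; case: allr; exists t; exact/negP.
by have := max_poly_roots p0 rs us; rewrite size_map size_iota ltnn.
Qed.

(** On the line through [x] and [y] both functions become nonzero univariate polynomials, and their
    product has a nonroot because [K] is infinite. *)
Lemma line_poly_nonzero2 f g x y : line_poly f -> line_poly g ->
  f x != 0 -> g y != 0 -> exists z, f z != 0 /\ g z != 0.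
Proof.
move=> Cf Cg fx gy; have [p pf] := Cf x (y - x); have [q qg] := Cg x (y - x).
have p0 : p != 0.
  by apply: contraNneq fx => p0; have := pf 0; rewrite p0 scale0r addr0 horner0 => ->.
have q0 : q != 0.
  apply: contraNneq gy => q0; have := qg 1.
  by rewrite q0 scale1r addrC subrK horner0 => ->.
have [t] : exists t, (p * q).[t] != 0 by apply: poly_nonroot; rewrite mulf_neq0.
by rewrite hornerM mulf_eq0 negb_or -pf -qg => /andP[? ?]; exists (x + t *: (y - x)).
Qed.

Definition zopen (O : X -> Prop) : Prop :=
  forall x, O x -> exists f, [/\ line_poly f, f x != 0 & forall y, f y != 0 -> O y].

Lemma zopen_neq0 f : line_poly f -> zopen (fun x => f x != 0).
Proof. by move=> Cf x fx; exists f. Qed.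

Lemma zopenT : zopen (fun=> True).
Proof.
by move=> x _; exists (fun=> 1); split=> //; [exact: (fa_const line_poly_algebra)|rewrite oner_eq0].
Qed.

Lemma zopenI O1 O2 : zopen O1 -> zopen O2 -> zopen (fun x => O1 x /\ O2 x).
Proof.
move=> o1 o2 x [/o1[f [Cf fx fO]] /o2[g [Cg gx gO]]]; exists (fun x => f x * g x); split.
- exact: (fa_mul line_poly_algebra).
- by rewrite mulf_neq0.
- by move=> y; rewrite mulf_eq0 negb_or => /andP[/fO ? /gO ?].
Qed.

Lemma zopen_meet O1 O2 x y : zopen O1 -> zopen O2 -> O1 x -> O2 y ->
  exists z, O1 z /\ O2 z.
Proof.
move=> o1 o2 /o1[f [Cf fx fO]] /o2[g [Cg gy gO]].
have [z [/fO ? /gO ?]] := line_poly_nonzero2 Cf Cg fx gy; by exists z.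
Qed.

Lemma zopen_forall (J : finType) (P : J -> Prop) (O : J -> X -> Prop) :
  (forall j, P j -> zopen (O j)) -> zopen (fun x => forall j, P j -> O j x).
Proof.
move=> oO x xP; have /choice[f fP] : forall j, exists f, [/\ line_poly f, f x != 0 &
    forall y, f y != 0 -> P j -> O j y].
  move=> j; case: (EM (P j)) => [Pj|nPj].
    by have [f [Cf fx fO]] := oO j Pj _ (xP j Pj); exists f; split=> // y /fO.
  by have [f [Cf fx _]] := zopenT (I : (fun=> True) x); exists f; split=> // y _ /nPj.
exists (fun y => \prod_j f j y); split.
- by apply: (fa_prod line_poly_algebra) => j _; case: (fP j).
- by apply/prodf_neq0 => j _; case: (fP j).
- by move=> y /prodf_neq0 fy j Pj; have [_ _] := fP j; apply=> //; apply: fy.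
Qed.

(** Irreducibility of affine space for finite families: generic conditions may be shown satisfiable
    one at a time, each with its own witness. *)
Lemma zopen_meet_forall (J : finType) (P : J -> Prop) (O : J -> X -> Prop) :
  (forall j, P j -> zopen (O j)) -> (forall j, P j -> exists x, O j x) ->
  exists x, forall j, P j -> O j x.
Proof.
move=> oO neO.
suff [x xP] : exists x, forall j, P j /\ j \in enum J -> O j x.
  by exists x => j Pj; apply: xP; rewrite mem_enum.
elim: (enum J) => [|j s [x xP]]; first by exists 0 => j [].
case: (EM (P j)) => [Pj|nPj]; last first.
  by exists x => k [Pk]; rewrite inE => /predU1P[kj|ks]; [case: nPj; rewrite -kj|apply: xP].
have [y yP] := neO j Pj.
have [|z [zP zO]] := zopen_meet (zopen_forall _) (oO j Pj) xP yP; first by move=> k [/oO].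
by exists z => k [Pk]; rewrite inE => /predU1P[->//|ks]; apply: zP.
Qed.

(** With [B] a right inverse at [x], the single function [\det (M y *m B)] is 1 at [x], and [M y]
    has a right inverse wherever it does not vanish; no minor has to be selected. *)
Lemma zopen_row_free m k (M : X -> 'M[K]_(m, k)) :
  fa_mx line_poly M -> zopen (fun x => row_free (M x)).
Proof.
move=> CM x /row_freeP[B MB]; exists (fun x => \det (M x *m B)); split.
- by apply: (fa_det line_poly_algebra); apply: (fa_mx_mul line_poly_algebra);
    last exact: (fa_mx_const line_poly_algebra).
- by rewrite MB det1 oner_eq0.
- move=> y; rewrite -unitfE -/(_ \in unitmx) => MBu.
  by apply/row_freeP; exists (B *m invmx (M y *m B)); rewrite mulmxA mulmxV.
Qed.

Lemma line_poly_eq0 f (O : X -> Prop) : line_poly f -> zopen O -> (exists x, O x) ->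
  (forall x, O x -> f x = 0) -> forall x, f x = 0.
Proof.
move=> Cf oO [y Oy] f0 x; apply/eqP/negP => /negP fx.
have [z [fz /f0 fz0]] := zopen_meet (zopen_neq0 Cf) oO fx Oy.
by rewrite fz0 eqxx in fz.
Qed.

End LinePolynomial.

(** * Linear dependence of rows *)

Section Orthogonality.
Variables (K : fieldType) (n : nat).
Implicit Types u v g h q : 'rV[K]_n.

(** Bilinear, without conjugation, hence polynomial in both arguments. A vector [h] stands for the
    hyperplane [dot v h = 0]. *)
Definition dot v h : K := (v *m h^T) 0 0.

Lemma dotE v h : dot v h = \sum_k v 0 k * h 0 k.
Proof. by rewrite /dot mxE; apply: eq_bigr => k _; rewrite mxE. Qed.

Lemma dotC v h : dot v h = dot h v.
Proof. by rewrite !dotE; apply: eq_bigr => k _; rewrite mulrC. Qed.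

Lemma dotDl u v h : dot (u + v) h = dot u h + dot v h.
Proof. by rewrite /dot mulmxDl mxE. Qed.

Lemma dotZl a v h : dot (a *: v) h = a * dot v h.
Proof. by rewrite /dot -scalemxAl mxE. Qed.

Lemma dotNl v h : dot (- v) h = - dot v h.
Proof. by rewrite /dot mulNmx mxE. Qed.

Lemma dotBl u v h : dot (u - v) h = dot u h - dot v h.
Proof. by rewrite dotDl dotNl. Qed.

Lemma dot0l h : dot 0 h = 0.
Proof. by rewrite /dot mul0mx mxE. Qed.

Lemma dotDr u v h : dot h (u + v) = dot h u + dot h v.
Proof. by rewrite !(dotC h) dotDl. Qed.

Lemma dotZr a v h : dot h (a *: v) = a * dot h v.
Proof. by rewrite !(dotC h) dotZl. Qed.

Lemma dotBr u v h : dot h (u - v) = dot h u - dot h v.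
Proof. by rewrite !(dotC h) dotBl. Qed.

Lemma dot0r h : dot h 0 = 0.
Proof. by rewrite dotC dot0l. Qed.

Definition dot_linear := (dotDl, dotBl, dotNl, dotZl, dot0l, dotDr, dotBr, dotZr, dot0r).

Lemma dot_delta v k : dot v (delta_mx 0 k) = v 0 k.
Proof.
rewrite dotE (bigD1 k) //= mxE !eqxx mulr1 big1 ?addr0 // => j /negPf jk.
by rewrite mxE jk andbF mulr0.
Qed.

Lemma dot_neq0 h : h != 0 -> exists u, dot u h = 1.
Proof.
case/rV0Pn => k hk; exists ((h 0 k)^-1 *: delta_mx 0 k).
by rewrite dotZl dotC dot_delta mulVf.
Qed.

(** Projection of [v] along [u] to the hyperplane of [h], multiplied by [dot u h] to clear the
    denominator. *)
Definition psi h u v := dot u h *: v - dot v h *: u.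

Lemma dot_psi h u v : dot (psi h u v) h = 0.
Proof. by rewrite /psi !dot_linear mulrC subrr. Qed.

Lemma dot_psi_orth h u v g : dot u g = 0 -> dot v g = 0 -> dot (psi h u v) g = 0.
Proof. by move=> ug vg; rewrite /psi !dot_linear ug vg !mulr0 subrr. Qed.

Lemma psi_id h u v : dot u h = 1 -> dot v h = 0 -> psi h u v = v.
Proof. by move=> uh vh; rewrite /psi uh vh scale1r scale0r subr0. Qed.

Lemma row_free0P m k (M : 'M[K]_(m, k)) :
  reflect (forall v : 'rV_m, v *m M = 0 -> v = 0) (row_free M).
Proof.
rewrite -kermx_eq0; apply: (iffP rowV0P) => vM v; last by move/sub_kermxP/vM.
by move/sub_kermxP/vM.
Qed.

Definition np g h := row_free (col_mx g h).

Lemma np_dual g h : np g h -> exists u, dot u g = 0 /\ dot u h = 1.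
Proof.
case/row_freeP => B GB; exists (row (rshift 1 0) B^T).
have E i : dot (row (rshift 1 0) B^T) (row i (col_mx g h)) = (i == rshift 1 0)%:R.
  rewrite dotC; transitivity ((col_mx g h *m B) i (rshift 1 0)).
    by rewrite dotE mxE; apply: eq_bigr => k _; rewrite !mxE.
  by rewrite GB mxE.
have := E (lshift 1 0); have := E (rshift 1 0).
by rewrite rowKd rowKu !row_id eqxx => -> ->.
Qed.

Lemma np_neq0l g h : np g h -> g != 0.
Proof.
move=> gh; apply/eqP => g0; move: gh; rewrite /np g0 => /row_freeP[B].
move/(congr1 (fun M : 'M_(1 + 1) => M (lshift 1 0) (lshift 1 0))).
by rewrite mul_col_mx col_mxEu mul0mx !mxE eqxx => /esym/eqP; rewrite oner_eq0.
Qed.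

Lemma np_sym g h : np g h -> np h g.
Proof. by rewrite /np /row_free -!addsmxE addsmxC. Qed.

Lemma npP g h : reflect (forall a b, a *: g + b *: h = 0 -> a = 0 /\ b = 0) (np g h).
Proof.
apply: (iffP (row_free0P _)) => [free a b ab|free v].
  have := free (row_mx a%:M b%:M); rewrite mul_row_col !mul_scalar_mx => /(_ ab) /rowP vE.
  split; first by have := vE (lshift 1 0); rewrite row_mxEl !mxE mulr1n.
  by have := vE (rshift 1 0); rewrite row_mxEr !mxE mulr1n.
rewrite -[v]hsubmxK mul_row_col {1}[lsubmx v]mx11_scalar {1}[rsubmx v]mx11_scalar.
rewrite !mul_scalar_mx => /free[a0 b0].
by rewrite [lsubmx v]mx11_scalar [rsubmx v]mx11_scalar a0 b0 !raddf0 row_mx0.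
Qed.

Lemma not_np g h q : ~ np g h -> dot h q != 0 -> g = (dot g q / dot h q) *: h.
Proof.
move=> gh hq; have h0 : h != 0 by apply: contraNneq hq => ->; rewrite dot0l.
apply: contrapT => gE; apply: gh; apply/npP => a b ab.
have a0 : a = 0.
  apply/eqP/negP => /negP a0; apply: gE.
  have -> : g = - (b / a) *: h.
    apply: (scalerI a0); rewrite scalerA mulrN mulrCA mulfV // mulr1 scaleNr.
    by apply/eqP; rewrite -addr_eq0 ab.
  by rewrite dotZl mulfK.
by split=> //; move: ab; rewrite a0 scale0r add0r => /eqP; rewrite scaler_eq0 (negPf h0) orbF => /eqP.
Qed.

Lemma np_neq q g h : dot g q = 1 -> dot h q = 1 -> g != h -> np g h.
Proof.
move=> gq hq gh; apply: contraT => /negP /not_np-/(_ q).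
by rewrite gq hq oner_eq0 divr1 scale1r => /(_ isT) /eqP; rewrite (negPf gh).
Qed.

End Orthogonality.

Section RowDependence.
Variables (K : fieldType) (d n : nat).
Implicit Types (A : 'M[K]_(d, n)) (S T : {set 'I_d}) (g h q : 'rV[K]_n).

Definition subrows S A : 'M[K]_(#|S|, n) := rowsub (fun i : 'I_#|S| => enum_val i) A.

Lemma sum_subrows A S (c : 'I_d -> K) : (forall i, i \notin S -> c i = 0) ->
  \sum_i c i *: row i A = (\row_i c (enum_val i)) *m subrows S A.
Proof.
move=> cS; rewrite mulmx_sum_row; transitivity (\sum_(i in S) c i *: row i A).
  by rewrite [RHS]big_mkcond /=; apply: eq_bigr => i _; case: ifPn => // /cS->; rewrite scale0r.
rewrite big_enum_val; apply: eq_bigr => i _; rewrite mxE; congr (_ *: _).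
by apply/rowP => j; rewrite !mxE.
Qed.

Lemma not_rowdep A S : ~ rowdep A S <-> row_free (subrows S A).
Proof.
split=> [ndep|/row_free0P free [c [[i iS ci] cS c0]]]; last first.
  move: c0; rewrite (sum_subrows _ cS) => /free/rowP/(_ (enum_rank_in iS i)).
  by rewrite !mxE enum_rankK_in // => c0; rewrite c0 eqxx in ci.
apply/row_free0P => v v0; apply/rowP => k; rewrite mxE; apply: contrapT => vk.
have kS : enum_val k \in S by apply: enum_valP.
apply: ndep; exists (fun e => if e \in S then v 0 (enum_rank_in kS e) else 0); split.
- by exists (enum_val k) => //; rewrite kS enum_valK_in; apply/eqP.
- by move=> e /negPf->.
- rewrite (@sum_subrows _ S) => [|e /negPf->//]; rewrite -[RHS]v0; congr (_ *m _).
  by apply/rowP => j; rewrite mxE enum_valP enum_valK_in.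
Qed.

Lemma rowdepS A S T : S \subset T -> rowdep A S -> rowdep A T.
Proof.
move=> ST [c [[i iS ci] cS c0]]; exists c; split=> //; first by exists i; rewrite ?(subsetP ST).
by move=> j jT; apply: cS; apply: contra jT; apply: subsetP.
Qed.

Definition orth A S g := forall e, e \in S -> dot (row e A) g = 0.

Lemma orthS A S T g : S \subset T -> orth A T g -> orth A S g.
Proof. by move=> /subsetP ST Tg e /ST/Tg. Qed.

Lemma indep_orth_rank A S r (G : 'M[K]_(r, n)) : ~ rowdep A S -> row_free G ->
  (forall i, orth A S (row i G)) -> (#|S| + r <= n)%N.
Proof.
move=> /not_rowdep/eqP rS /eqP rG ort.
have /mulmx0_rank_max : subrows S A *m G^T = 0.
  apply/matrixP => i j; rewrite !mxE -[RHS](ort j (enum_val i)) ?enum_valP //.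
  by rewrite dotE; apply: eq_bigr => k _; rewrite !mxE.
by rewrite mxrank_tr rS rG.
Qed.

Lemma indep_card A S : ~ rowdep A S -> (#|S| <= n)%N.
Proof. by move/not_rowdep/eqP <-; apply: rank_leq_col. Qed.

Lemma card_rowdep A S : (n < #|S|)%N -> rowdep A S.
Proof. by move=> nS; apply: contrapT => /indep_card; rewrite leqNgt nS. Qed.

Lemma orth_rowdep A S g : g != 0 -> orth A S g -> (n <= #|S|)%N -> rowdep A S.
Proof.
move=> g0 Sg nS; have rg : row_free g by rewrite /row_free rank_rV g0.
apply: contrapT => /indep_orth_rank /(_ rg) H.
have : (#|S| + 1 <= n)%N by apply: H => i; rewrite row_id.
by rewrite addn1 ltnNge nS.
Qed.

Lemma orth2_rowdep A S g h : np g h -> orth A S g -> orth A S h -> (n <= #|S|.+1)%N ->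
  rowdep A S.
Proof.
move=> gh Sg Sh nS; apply: contrapT => /indep_orth_rank /(_ gh) H.
have : (#|S| + 2 <= n)%N.
  by apply: H => i; case: (split_ordP i) => i' ->; rewrite ?rowKu ?rowKd row_id.
by rewrite addn2 ltnNge nS.
Qed.

Lemma orth_parallel A S g h q : ~ rowdep A S -> (n <= #|S|.+1)%N -> orth A S g ->
  orth A S h -> dot h q != 0 -> g = (dot g q / dot h q) *: h.
Proof.
move=> indS nS Sg Sh hq; apply: not_np hq => gh.
exact/indS/(orth2_rowdep gh Sg Sh).
Qed.

Lemma orth_det A S g (f : 'I_n -> 'I_d) : g != 0 -> orth A S g -> (forall i, f i \in S) ->
  \det (rowsub f A) = 0.
Proof.
move=> g0 Sg fS; apply/eqP; rewrite -det_tr; apply/det0P; exists g => //.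
apply/rowP => i; rewrite mxE [RHS]mxE -[RHS](Sg (f i)) // dotC dotE.
by apply: eq_bigr => k _; rewrite !mxE.
Qed.

(** If the rows on [S] span, some [n] of them form an invertible matrix. This expresses the
    existence of a common normal by polynomial equations, so that it passes to Zariski closures. *)
Lemma det_orth A S : (forall f : 'I_n -> 'I_d, (forall i, f i \in S) -> \det (rowsub f A) = 0) ->
  exists g, g != 0 /\ orth A S g.
Proof.
move=> detS; pose M := rows_in A S.
have [full|nfull] := boolP (row_full M).
  have u : rowsub (fullrankfun full) M \in unitmx.
    by rewrite -row_full_unit; apply: fullrowsub_full.
  (* Rows of [M] outside [S] are zero and cannot occur in an invertible selection. *)
  have fS i : fullrankfun full i \in S.
    apply: contraTT u => iS; rewrite unitmxE unitfE negbK; apply/det0P.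
    exists (delta_mx 0 i); first by apply/rV0Pn; exists i; rewrite mxE !eqxx oner_eq0.
    by rewrite -rowE; apply/rowP => j; rewrite !mxE (negPf iS).
  have := detS _ fS; move: u; rewrite unitmxE unitfE.
  have -> : rowsub (fullrankfun full) M = rowsub (fullrankfun full) A.
    by apply/matrixP => i j; rewrite !mxE fS.
  by move=> /eqP.
have : ~~ row_free M^T by rewrite /row_free mxrank_tr.
move/(row_free0P _)/existsNP => [g /not_implyP[gM /eqP g0]]; exists g; split=> // e eS.
have /rowP/(_ e) := gM; rewrite mxE [RHS]mxE => <-; rewrite dotC dotE.
by apply: eq_bigr => k _; rewrite !mxE eS.
Qed.

Lemma inj_rowdep_det A (f : 'I_n -> 'I_d) :
  (injective f -> rowdep A [set f i | i in 'I_n]) -> \det (rowsub f A) = 0.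
Proof.
move=> dep; have [/injectiveP finj|/injectivePn[i [j ij fij]]] := boolP (injectiveb f).
  have [c [[e /imsetP[k _ ->] ck] cS c0]] := dep finj.
  apply/eqP/det0P; exists (\row_i c (f i)).
    by apply/rV0Pn; exists k; rewrite mxE.
  rewrite -[RHS]c0 mulmx_sum_row [RHS](bigID (fun e => e \in [set f i | i in 'I_n])) /=.
  rewrite [X in _ = _ + X]big1 ?addr0 => [|i /cS->]; last by rewrite scale0r.
  rewrite big_imset; last by move=> ? ? _ _; apply: finj.
  by apply: eq_bigr => i _; rewrite mxE row_rowsub.
apply: (determinant_alternate ij) => k; by rewrite !mxE fij.
Qed.

(** Turns the dependencies imposed on a dependent hyperplane into one normal vector, the form in
    which the geometric argument uses them. *)
Lemma subsets_rowdep_orth A S : (forall T, T \subset S -> #|T| = n -> rowdep A T) ->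
  exists g, g != 0 /\ orth A S g.
Proof.
move=> dep; apply: det_orth => f fS; apply: inj_rowdep_det => finj; apply: dep.
  by apply/subsetP => e /imsetP[i _ ->].
by rewrite card_imset // card_ord.
Qed.

End RowDependence.

(** * Labelings of the dependent hyperplanes *)

Lemma subset_extend (T : finType) (U B : {set T}) m :
  U \subset B -> (#|U| <= m)%N -> (m <= #|B|)%N ->
  exists C : {set T}, [/\ U \subset C, C \subset B & #|C| = m].
Proof.
move=> UB Um mB; elim: m Um mB => [|m IHm] Um mB.
  by exists U; split=> //; apply/eqP; rewrite -leqn0.
move: Um; rewrite leq_eqVlt => /predU1P[Um|Um]; first by exists U.
have [C [UC CB Cm]] := IHm Um (ltnW mB).
have /subsetPn[x xB xC] : ~~ (B \subset C).
  by apply: contraL mB => /subset_leq_card; rewrite Cm -ltnNge.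
exists (x |: C); split; last by rewrite cardsU1 xC Cm.
  by apply: subset_trans UC (subsetUr _ _).
by rewrite subUset sub1set xB.
Qed.

(** What the geometry retains of a tame paving matroid; see [paving_line_system]. *)
Record line_system (d n : nat) (D : {set {set 'I_d}}) : Prop := LineSystem {
  line_card : forall l, l \in D -> (n <= #|l|)%N;
  line_rank : forall l, l \in D -> (0 < n)%N;
  line_meet : forall l l', l \in D -> l' \in D -> l != l' -> (#|l :&: l'| + 2 <= n)%N;
  line_tame : forall l1 l2 l3, l1 \in D -> l2 \in D -> l3 \in D ->
    l1 != l2 -> l1 != l3 -> l2 != l3 -> l1 :&: l2 :&: l3 = set0 }.

Section Labels.
Variables (d n : nat) (L : finType) (D : {set {set 'I_d}}).
Hypothesis LS : line_system n D.
Implicit Types (c : {set 'I_d} -> L) (e : 'I_d) (k : L) (l : {set 'I_d}).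

Definition labels c e : seq L := undup [seq c l | l <- enum [set l in D | e \in l]].

Lemma labelsP c e k :
  reflect (exists l, [/\ l \in D, e \in l & c l = k]) (k \in labels c e).
Proof.
rewrite mem_undup; apply: (iffP mapP) => [[l]|[l [lD el <-]]].
  by rewrite mem_enum inE => /andP[lD el] ->; exists l.
by exists l => //; rewrite mem_enum inE lD.
Qed.

Lemma labels_line c e l : l \in D -> e \in l -> c l \in labels c e.
Proof. by move=> lD el; apply/labelsP; exists l. Qed.

Lemma tame_lines e l1 l2 l3 : l1 \in D -> l2 \in D -> l3 \in D ->
  e \in l1 -> e \in l2 -> e \in l3 -> [|| l1 == l2, l1 == l3 | l2 == l3].
Proof.
move=> D1 D2 D3 e1 e2 e3; apply: contraT; rewrite !negb_or => /and3P[n12 n13 n23].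
by have /setP/(_ e) := line_tame LS D1 D2 D3 n12 n13 n23; rewrite !inE e1 e2 e3.
Qed.

Lemma labels_tame c e k1 k2 k3 : k1 \in labels c e -> k2 \in labels c e ->
  k3 \in labels c e -> [|| k1 == k2, k1 == k3 | k2 == k3].
Proof.
move=> /labelsP[l1 [D1 e1 <-]] /labelsP[l2 [D2 e2 <-]] /labelsP[l3 [D3 e3 <-]].
by case/or3P: (tame_lines D1 D2 D3 e1 e2 e3) => /eqP->; rewrite eqxx ?orbT.
Qed.

Variant labels_spec c e : seq L -> Prop :=
| NoLabel : labels_spec c e [::]
| OneLabel k : labels_spec c e [:: k]
| TwoLabels k k' of k != k' : labels_spec c e [:: k; k'].

Lemma labels_case c e : labels_spec c e (labels c e).
Proof.
have := @labels_tame c e; have : uniq (labels c e) by apply: undup_uniq.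
case: (labels c e) => [|k1 [|k2 [|k3 s]]]; [by constructor|by constructor| |].
  by rewrite /= inE => /andP[k12 _] _; constructor.
move=> + /(_ k1 k2 k3); rewrite /= !inE !eqxx !orbT => + /(_ isT isT isT).
by case/and3P=> /norP[/negPf-> /norP[/negPf-> _]] /norP[/negPf-> _].
Qed.

Definition Hset c k : {set 'I_d} := [set e | k \in labels c e].

Lemma line_sub_Hset c l : l \in D -> l \subset Hset c (c l).
Proof. by move=> lD; apply/subsetP => e el; rewrite inE labels_line. Qed.

Definition used c k := exists2 l, l \in D & c l = k.

Lemma used_labels c e k : k \in labels c e -> used c k.
Proof. by case/labelsP => l [lD _ <-]; exists l. Qed.

Lemma two_used_rank c k k' : used c k -> used c k' -> k != k' -> (2 <= n)%N.
Proof.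
move=> [l lD <-] [l' lD' <-] cl; have ll' : l != l' by apply: contraNneq cl => ->.
exact: leq_trans (leq_addl _ _) (line_meet LS lD lD' ll').
Qed.

(** Condition (ii) of a nice partition, for the partition of the lines into the fibres of [c]. *)
Definition separated c := forall l k, l \in D -> used c k -> c l != k -> ~~ (l \subset Hset c k).

(** Otherwise every subset of [l] of size below [n] lies in the union of another label. For a
    singleton [x] this gives a second line through [x], so [n] is at least 3; the pair of [x] and a
    point [y] of [l] outside that union then gives three labels at [x], against tameness. *)
Lemma separated_subset c l : separated c -> l \in D ->
  exists T : {set 'I_d}, [/\ T \subset l, #|T|.+1 = n &
    forall k, used c k -> c l != k -> ~~ (T \subset Hset c k)].
Proof.
move=> sep lD; apply: contrapT => noT.
have n0 := line_rank LS lD; have ln := line_card LS lD.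
have sub (U : {set 'I_d}) : U \subset l -> (#|U| < n)%N ->
    exists k, [/\ used c k, c l != k & U \subset Hset c k].
  move=> Ul Un; apply: contrapT => nok; apply: noT.
  have [T [UT Tl Tn]] : exists T : {set 'I_d}, [/\ U \subset T, T \subset l & #|T| = n.-1].
    apply: subset_extend => //; first by rewrite -ltnS prednK.
    exact: leq_trans (leq_pred n) ln.
  exists T; split; [by []|by rewrite Tn prednK|move=> k ku ck].
  by apply/negP => Tk; apply: nok; exists k; split=> //; apply: subset_trans Tk.
have [x xl] : exists x, x \in l by apply/card_gt0P; apply: (leq_trans n0 ln).
have [k [ku ck _]] : exists k, [/\ used c k, c l != k & set0 \subset Hset c k].
  by apply: sub; rewrite ?sub0set ?cards0.
have n2 : (1 < n)%N by apply: (two_used_rank _ ku ck); exists l.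
have meet3 l' y : l' \in D -> l != l' -> y \in l -> y \in l' -> (2 < n)%N.
  move=> lD' ll' yl yl'; apply: leq_trans (line_meet LS lD lD' ll').
  by rewrite addn2 !ltnS; apply/card_gt0P; exists y; rewrite inE yl.
have [kx [kxu ckx]] : exists k, [/\ used c k, c l != k & [set x] \subset Hset c k].
  by apply: sub; rewrite ?sub1set ?cards1.
rewrite sub1set inE => xk.
have n3 : (2 < n)%N.
  have [l' [lD' xl' cl']] := labelsP _ _ _ xk; apply: (meet3 l' x) => //.
  by apply: contraNneq ckx => ->; rewrite cl'.
have [y yl ynk] := subsetPn (sep l kx lD kxu ckx).
have [ky [kyu cky]] : exists k, [/\ used c k, c l != k & [set x; y] \subset Hset c k].
  apply: sub; first by apply/subsetP => z /set2P[] ->.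
  by rewrite cards2; case: (x != y).
rewrite subUset !sub1set !inE => /andP[xky yky].
have := labels_tame (labels_line c lD xl) xk xky.
rewrite (negPf ckx) (negPf cky) /= => /eqP kxy.
by rewrite inE kxy yky in ynk.
Qed.

End Labels.

(** * The variety of a labeling *)

Section Parametrization.
Variables (K : numFieldType) (d n : nat) (L : finType) (D : {set {set 'I_d}}).
Hypothesis LS : line_system n D.
Implicit Types (c : {set 'I_d} -> L) (e : 'I_d) (k : L) (l S : {set 'I_d}).
Implicit Types (A : 'M[K]_(d, n)).

Definition param := {ffun L + 'I_d * 'I_3 -> 'rV[K]_n}.
Implicit Types x : param.

Definition normal k x : 'rV[K]_n := x (inl k).
Definition par e (j : 'I_3) x : 'rV[K]_n := x (inr (e, j)).
Local Notation u e x := (par e ord0 x).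
Local Notation v e x := (par e (lift ord0 ord0) x).
Local Notation w e x := (par e ord_max x).

Lemma param_algebra : function_algebra (@line_poly K param).
Proof. exact: line_poly_algebra. Qed.

Lemma line_poly_coord i : fa_mx (@line_poly K param) (fun x => x i).
Proof.
move=> a b x y; exists (((x : param) i a b)%:P + ((y : param) i a b)%:P * 'X) => t.
by rewrite !ffunE !mxE hornerD hornerM !hornerC hornerX mulrC.
Qed.

Lemma fa_dot (X : Type) (C : (X -> K) -> Prop) (f g : X -> 'rV[K]_n) : function_algebra C ->
  fa_mx C f -> fa_mx C g -> C (fun z => dot (f z) (g z)).
Proof.
move=> CA Cf Cg; apply: (fa_ext CA) (fa_sum CA _ (fun j _ => fa_mul CA (Cf 0 j) (Cg 0 j))) => x.
by rewrite dotE.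
Qed.

Lemma fa_psi (X : Type) (C : (X -> K) -> Prop) (h f g : X -> 'rV[K]_n) : function_algebra C ->
  fa_mx C h -> fa_mx C f -> fa_mx C g -> fa_mx C (fun z => psi (h z) (f z) (g z)).
Proof.
move=> CA Ch Cf Cg; apply: (fa_mx_add CA); last apply: (fa_mx_opp CA).
  by apply: (fa_mx_scale CA) => //; apply: fa_dot.
by apply: (fa_mx_scale CA) => //; apply: fa_dot.
Qed.

(** With two labels, [v] and the direction [w] are first projected along [u] into the first
    hyperplane; the projection along the image of [w] then stays inside it. *)
Definition pvec c e x : 'rV[K]_n :=
  match labels D c e with
  | [::] => v e x
  | [:: k] => psi (normal k x) (u e x) (v e x)
  | k :: k' :: _ =>
      psi (normal k' x) (psi (normal k x) (u e x) (w e x)) (psi (normal k x) (u e x) (v e x))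
  end.

Definition phi c x : 'M[K]_(d, n) := \matrix_e pvec c e x.

Lemma row_phi c x e : row e (phi c x) = pvec c e x.
Proof. by rewrite rowK. Qed.

Lemma line_poly_phi c : fa_mx (@line_poly K param) (phi c).
Proof.
have LA := param_algebra.
suff H e : fa_mx (@line_poly K param) (pvec c e).
  by move=> e j; apply: (fa_ext LA) (H e 0 j) => x; rewrite mxE.
rewrite /pvec; case: (labels D c e) => [|k [|k' _]]; first exact: line_poly_coord.
  by apply: (fa_psi LA); apply: line_poly_coord.
by apply: (fa_psi LA); [|apply: (fa_psi LA)..]; apply: line_poly_coord.
Qed.

Lemma phi_orth_label c x e k : k \in labels D c e -> dot (row e (phi c x)) (normal k x) = 0.
Proof.
rewrite row_phi /pvec; case: (labels_case LS c e) => [//|k1|k1 k2 _]; rewrite !inE.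
  by move/eqP->; apply: dot_psi.
case/orP=> /eqP->; last exact: dot_psi.
by apply: dot_psi_orth; apply: dot_psi.
Qed.

Lemma phi_orth c x k : orth (phi c x) (Hset D c k) (normal k x).
Proof. by move=> e; rewrite inE; apply: phi_orth_label. Qed.

Lemma phi_orth_line c x l : l \in D -> orth (phi c x) l (normal (c l) x).
Proof. by move=> lD; apply: (orthS (line_sub_Hset c lD)); apply: phi_orth. Qed.

(** [psi h u] fixes the hyperplane of [h] once [dot u h = 1], so the rows of [A] themselves serve as
    [v]. With two labels, independence of the normals supplies a second direction inside the first
    hyperplane. *)
Lemma phi_surj c A (h : L -> 'rV[K]_n) : 
  (forall k, used D c k -> h k != 0) ->
  (forall k k', used D c k -> used D c k' -> k != k' -> np (h k) (h k')) ->
  (forall e k, k \in labels D c e -> dot (row e A) (h k) = 0) ->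
  exists x, phi c x = A /\ forall k, normal k x = h k.
Proof.
move=> h0 hnp hA.
have [f fP] : exists f : 'I_d -> 'I_3 -> 'rV[K]_n, forall e, match labels D c e with
   | [::] => f e (lift ord0 ord0)
   | [:: k] => psi (h k) (f e ord0) (f e (lift ord0 ord0))
   | k :: k' :: _ => psi (h k') (psi (h k) (f e ord0) (f e ord_max))
                         (psi (h k) (f e ord0) (f e (lift ord0 ord0)))
  end = row e A.
  suff /choice[f fP]: forall e, exists f : 'I_3 -> 'rV[K]_n, match labels D c e with
   | [::] => f (lift ord0 ord0)
   | [:: k] => psi (h k) (f ord0) (f (lift ord0 ord0))
   | k :: k' :: _ => psi (h k') (psi (h k) (f ord0) (f ord_max))
                         (psi (h k) (f ord0) (f (lift ord0 ord0)))
  end = row e A by exists f.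
  move=> e; have := hA e; have := @used_labels _ _ D c e.
  case: (labels_case LS c e) => [_ _|k /(_ k) ku /(_ k) hk|k k' kk' ku hk].
  - by exists (fun=> row e A).
  - have [a ha] := dot_neq0 (h0 k (ku (mem_head _ _))).
    exists (fun j => if j == ord0 then a else row e A) => /=.
    by rewrite psi_id // hk ?mem_head.
  - have k1 : k \in [:: k; k'] by rewrite mem_head.
    have k2 : k' \in [:: k; k'] by rewrite !inE eqxx orbT.
    have [a ha] := dot_neq0 (h0 k (ku _ k1)).
    have [b [bh bh']] := np_dual (hnp _ _ (ku _ k1) (ku _ k2) kk').
    exists (fun j => if j == ord0 then a else if j == ord_max then b else row e A) => /=.
    by rewrite !(@psi_id _ _ (h k)) ?psi_id // hk.
exists [ffun i => match i with inl k => h k | inr (e, j) => f e j end].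
split=> [|k]; last by rewrite /normal ffunE.
apply/row_matrixP => e; rewrite row_phi -fP /pvec /normal /par.
by case: (labels D c e) => [|k [|k' _]]; rewrite !ffunE.
Qed.

Lemma phi_surj_lines c A (h : {set 'I_d} -> 'rV[K]_n) :
  (forall l, l \in D -> h l != 0) ->
  (forall l l', l \in D -> l' \in D -> c l = c l' -> h l = h l') ->
  (forall l l', l \in D -> l' \in D -> c l != c l' -> np (h l) (h l')) ->
  (forall l, l \in D -> orth A l (h l)) ->
  exists x, phi c x = A /\ forall l, l \in D -> normal (c l) x = h l.
Proof.
move=> h0 heq hnp hA.
pose hh k := if [pick l in D | c l == k] is Some l then h l else 0.
have hhE l : l \in D -> hh (c l) = h l.
  move=> lD; rewrite /hh; case: pickP => [l' /andP[lD' /eqP cl']|/(_ l)].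
    exact: heq.
  by rewrite lD eqxx.
have [k [l lD <-]|k k' [l lD <-] [l' lD' <-] cl|e k /labelsP[l [lD el <-]]|x [xA xh]] :=
  @phi_surj c A hh.
- by rewrite hhE // h0.
- by rewrite !hhE // hnp.
- by rewrite hhE // hA.
- by exists x; split=> // l lD; rewrite xh hhE.
Qed.

Definition variety c : 'M[K]_(d, n) -> Prop := zclosure (fun A => exists x, A = phi c x).

Lemma variety_phi c x : variety c (phi c x).
Proof. by move=> p; apply; exists x. Qed.

Lemma zclosureS (X Y : 'M[K]_(d, n) -> Prop) : (forall A, X A -> zclosure Y A) ->
  forall A, zclosure X A -> zclosure Y A.
Proof. by move=> XY A XA p pY; apply: XA => B /XY; apply. Qed.

Lemma line_poly_mpeval c p : line_poly (fun x => mpeval p (phi c x)).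
Proof. by apply: (fa_mpeval param_algebra); apply: line_poly_phi. Qed.

(** A polynomial vanishing on [X] vanishes on an open set of parameters, hence on all of them;
    inclusions of varieties need only be checked generically. *)
Lemma dense_variety_sub c (X : 'M[K]_(d, n) -> Prop) (O : param -> Prop) :
  zopen O -> (exists x, O x) -> (forall x, O x -> zclosure X (phi c x)) ->
  forall A, variety c A -> zclosure X A.
Proof.
move=> oO neO OX; apply: zclosureS => A [x ->] p pX.
by apply: (line_poly_eq0 (line_poly_mpeval c p) oO neO) => y /OX; apply.
Qed.

(** The variety is the closure of the image of an affine space: two polynomials witnessing that the
    image leaves [Z1] and [Z2] would both be nonzero at a common parameter. *)
Lemma variety_irreducible c : irreducible (variety c).
Proof.
split; first by exists (phi c 0); apply: variety_phi.
move=> Z1 Z2 [P1 Z1P] [P2 Z2P] cov; apply: contrapT => /not_orP[nZ1 nZ2].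
have out (Z : 'M[K]_(d, n) -> Prop) P : (forall A, Z A <-> forall p, P p -> mpeval p A = 0) ->
    ~ (forall A, variety c A -> Z A) -> exists p x, P p /\ mpeval p (phi c x) != 0.
  move=> ZP nZ; apply: contrapT => noP; apply: nZ => A VA; apply/ZP => p Pp.
  apply: VA => _ [x ->]; apply/eqP; apply: contraT => px.
  by case: noP; exists p, x.
have [p [x [Pp px]]] := out _ _ Z1P nZ1; have [q [y [Pq qy]]] := out _ _ Z2P nZ2.
have [z [pz qz]] := line_poly_nonzero2 (line_poly_mpeval c p) (line_poly_mpeval c q) px qy.
by case: (cov _ (@variety_phi c z)) => [/Z1P/(_ p Pp)/eqP|/Z2P/(_ q Pq)/eqP]; apply/negP.
Qed.

Lemma zopen_indep_mx (X : lmodType K) (M : X -> 'M[K]_(d, n)) S : fa_mx (@line_poly K X) M ->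
  zopen (fun z => ~ rowdep (M z) S).
Proof.
move=> CM z /not_rowdep free.
have [|f [Cf fz fP]] := @zopen_row_free _ _ _ _ (fun z => subrows S (M z)) _ z free.
  exact: (fa_mx_rowsub (line_poly_algebra X)).
by exists f; split=> // y /fP/not_rowdep.
Qed.

Lemma zopen_indep c S : zopen (fun x => ~ rowdep (phi c x) S).
Proof. exact/zopen_indep_mx/line_poly_phi. Qed.

Lemma zopen_np k k' : zopen (fun x => np (normal k x) (normal k' x)).
Proof.
apply: zopen_row_free; apply: (fa_mx_col_mx param_algebra);
  exact: line_poly_coord.
Qed.

(** The hypotheses of [phi_surj] on the normals, as a condition on the parameter. *)
Definition np_param c x := 
  (forall k, used D c k -> normal k x != 0) /\
  (forall k k', used D c k -> used D c k' -> k != k' -> np (normal k x) (normal k' x)).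

Lemma mpoly_fun_det (f : 'I_n -> 'I_d) : mpoly_fun (fun A => \det (rowsub f A)).
Proof.
apply: (fa_det (mpoly_fun_algebra K d n)).
exact/(fa_mx_rowsub (mpoly_fun_algebra K d n))/mpoly_fun_id.
Qed.

End Parametrization.

(** * Existence of generic parameters *)

Section GenericParameters.
Variables (K : numFieldType) (d n : nat) (L : finType) (D : {set {set 'I_d}}).
Hypothesis LS : line_system n D.
Implicit Types (c : {set 'I_d} -> L) (e : 'I_d) (k : L) (l S : {set 'I_d}).
Local Notation param := (param K d n L).
Local Notation Hset := (Hset D).
Local Notation used := (used D).

Lemma card_out (J : finType) (Z : {set J}) : (#|Z| < #|J|)%N -> exists b, b \notin Z.
Proof.
move=> ZJ; have : (0 < #|~: Z|)%N by rewrite cardsCs setCK subn_gt0.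
by case/card_gt0P => b; rewrite inE; exists b.
Qed.

Section Weights.
Variables (m : nat) (Z : L -> {set 'I_m}).

(* Affine weights: for k <> k' no two of the columns (k + b, k' + b) are proportional. *)
Definition weights k : 'rV[K]_m :=
  \row_b (if b \in Z k then 0 else (enum_rank k + b).+1%:R).

Lemma weights_neq0 k : (#|Z k| < m)%N -> weights k != 0.
Proof.
move=> Zm; have [b bZ] : exists b, b \notin Z k by apply: card_out; rewrite card_ord.
apply/rV0Pn; exists b.
by rewrite mxE (negPf bZ) pnatr_eq0.
Qed.

(** With different supports, a coordinate where only one weight vanishes kills one of the
    coefficients. With equal supports there are two coordinates where both weights are nonzero, and
    affine weights with distinct offsets are not proportional on them. *)
Lemma weights_np k k' : (#|Z k| < m)%N -> (#|Z k'| < m)%N -> k != k' ->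
  (Z k = Z k' -> (#|Z k| + 2 <= m)%N) -> np (weights k) (weights k').
Proof.
move=> Zk Zk' kk' Zeq; apply/npP => a b /rowP ab.
have abE t : a * weights k 0 t + b * weights k' 0 t = 0 by have := ab t; rewrite !mxE.
have fin (r r' : K) g : r * 0 + r' * g = 0 -> g != 0 -> r' = 0.
  by rewrite mulr0 add0r => /eqP; rewrite mulf_eq0 => /orP[/eqP//|->].
have s0 (r : K) g : g != 0 -> r *: g = 0 :> 'rV_m -> r = 0.
  by move=> g0 /eqP; rewrite scaler_eq0 (negPf g0) orbF => /eqP.
have ab0 : a *: weights k + b *: weights k' = 0 by apply/rowP.
have [ZE|] := eqVneq (Z k) (Z k').
  have [t tZ] : exists t, t \notin Z k by apply: card_out; rewrite card_ord.
  have [t'] : exists t', t' \notin t |: Z k.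
    apply: card_out; rewrite card_ord cardsU1 tZ; apply: leq_trans (Zeq ZE).
    by rewrite addn2 add1n.
  rewrite !inE negb_or => /andP[tt' t'Z].
  have := abE t; have := abE t'; rewrite !mxE -ZE (negPf tZ) (negPf t'Z).
  rewrite -!addSn !natrD => e1 e2.
  have ba : b = - a.
    have : (a + b) * (t%:R - t'%:R) = 0.
      by rewrite -[RHS](subrr 0) -{1}e2 -e1; ring.
    move/eqP; rewrite mulf_eq0 subr_eq0 eqr_nat => /orP[|/eqP/val_inj tE].
      by rewrite addrC addr_eq0 => /eqP.
    by rewrite tE eqxx in tt'.
  suff a0 : a = 0 by rewrite ba a0 oppr0.
  move: e1; rewrite ba mulNr -mulrBr => /eqP; rewrite mulf_eq0 => /orP[/eqP//|].
  rewrite opprD addrACA subrr addr0 subr_eq0 eqr_nat eqSS => /eqP/val_inj/enum_rank_inj kE.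
  by rewrite kE eqxx in kk'.
rewrite eqEsubset negb_and => /orP[] /subsetPn[t tZ tZ'].
  have b0 : b = 0.
    apply: (@fin a b (weights k' 0 t)); last by rewrite mxE (negPf tZ') pnatr_eq0.
    by have := abE t; rewrite {1}mxE tZ.
  by move: ab0; rewrite b0 scale0r addr0 => /(s0 _ _ (weights_neq0 Zk)) ->.
have a0 : a = 0.
  apply: (@fin b a (weights k 0 t)); last by rewrite mxE (negPf tZ') pnatr_eq0.
  by have := abE t; rewrite addrC {1}mxE tZ.
by move: ab0; rewrite a0 scale0r add0r => /(s0 _ _ (weights_neq0 Zk')) ->.
Qed.

End Weights.

(** The rows of [S] become distinct standard basis vectors, the others 0, and the normal of [k]
    vanishes exactly at the coordinates of [S :&: Hset c k]. The bounds make these normals nonzero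
    and pairwise independent. *)
Lemma exists_indep c S : (#|S| <= n)%N ->
  (forall k, used c k -> #|S :&: Hset c k| < n)%N ->
  (forall k k', used c k -> used c k' -> k != k' ->
     #|S :&: (Hset c k :&: Hset c k')| + 2 <= n)%N ->
  exists x : param, np_param D c x /\ ~ rowdep (phi D c x) S.
Proof.
case: (posnP n) => [n0|n0] Sn Hn HHn.
  have nou k : ~ used c k by case=> l /(line_rank LS); rewrite n0.
  exists 0; split; first by split=> [k /nou|k k' /nou].
  move=> [a [[i iS _] _ _]]; move: Sn.
  by rewrite n0 leqn0 cards_eq0 => /eqP S0; rewrite S0 inE in iS.
(* Elements of [S] are numbered by their position in [enum S]; the default of [insubd] is never met
   on [S]. *)
have fP : exists f : 'I_d -> 'I_n, {in S &, injective f}.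
  exists (fun e => insubd (Ordinal n0) (index e (enum S))) => i j iS jS /(congr1 val).
  rewrite !val_insubd.
  have lt e : e \in S -> (index e (enum S) < n)%N.
    by move=> eS; apply: leq_trans Sn; rewrite cardE index_mem mem_enum.
  rewrite !lt // => /(congr1 (nth i (enum S))).
  by rewrite !nth_index ?mem_enum.
have [f finj] := fP; pose Z k := f @: (S :&: Hset c k).
have ZE k : #|Z k| = #|S :&: Hset c k|.
  by apply: card_in_imset => i j /setIP[iS _] /setIP[jS _]; apply: finj.
have Zn k : used c k -> (#|Z k| < n)%N by rewrite ZE; apply: Hn.
pose A : 'M[K]_(d, n) := \matrix_e (if e \in S then delta_mx 0 (f e) else 0).
have wnp k k' : used c k -> used c k' -> k != k' -> np (weights Z k) (weights Z k').
  move=> ku ku' kk'; apply: weights_np => //; try exact: Zn.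
  move=> ZZ; rewrite ZE; have <- : S :&: (Hset c k :&: Hset c k') = S :&: Hset c k.
    apply/setP => e; rewrite !inE; apply/andP/andP => [[-> /andP[-> _]]//|[eS ek]].
    split=> //; rewrite ek /=; have : f e \in Z k' by rewrite -ZZ imset_f // !inE eS.
    case/imsetP => e' /setIP[e'S]; rewrite inE => e'k' /finj fe.
    by rewrite (fe eS e'S).
  exact: HHn.
have [k ku|k k' ku ku' kk'|e k ke|x [xA xh]] := @phi_surj K d n L D LS c A (weights Z).
- exact/weights_neq0/Zn.
- exact: wnp.
- rewrite rowK; case: ifP => eS; last by rewrite dot0l.
  by rewrite dotC dot_delta mxE imset_f // !inE eS.
- exists x; split.
    by split=> [k ku|k k' ku ku' kk']; rewrite !xh; [exact/weights_neq0/Zn|exact: wnp].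
  move=> [a [[i iS ai] aS a0]]; move/rowP/(_ (f i)): a0.
  rewrite summxE (bigD1 i) //= big1 => [|j ji].
    by rewrite xA rowK iS !mxE !eqxx mulr1 addr0 => a0; rewrite a0 eqxx in ai.
  have [jS|/aS->] := boolP (j \in S); last by rewrite scale0r mxE.
  rewrite xA rowK jS !mxE eqxx /=.
  case: eqP => [fij|]; last by rewrite mulr0.
  by have ij : j = i by [apply: finj]; rewrite ij eqxx in ji.
Qed.

Lemma zopen_np_param c : zopen (@np_param K d n L D c).
Proof.
move=> x [x0 xnp].
pose P (kk : L * L) := [/\ used c kk.1, used c kk.2 & kk.1 != kk.2].
have o1 : zopen (fun x : param => forall k, used c k -> normal k x != 0).
  apply: zopen_forall => k _ y y0.
  have rf : row_free (normal k y) by rewrite /row_free rank_rV y0.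
  have [f [Cf fy fP]] := @zopen_row_free _ _ _ _ (fun x : param => normal k x)
    (line_poly_coord _) _ rf.
  by exists f; split=> // z /fP; rewrite /row_free rank_rV; case: (normal k z != 0).
have o2 : zopen (fun x : param => forall kk, P kk -> np (normal kk.1 x) (normal kk.2 x)).
  by apply: zopen_forall => kk _; apply: zopen_np.
have [|y yP] := zopenI o1 o2 (x := x).
  by split=> // -[k k'] [/= ku ku' kk']; apply: xnp.
case: yP => Cy yx yP; exists y; split=> // z /yP[z0 znp]; split=> // k k' ku ku' kk'.
by apply: (znp (k, k')).
Qed.

Lemma exists_np_param c : exists x : param, np_param D c x.
Proof.
have [||k k' ku ku' kk'|x [xnp _]] := @exists_indep c set0; rewrite ?cards0 //.
- by move=> k [l lD _]; rewrite set0I cards0 (line_rank LS lD).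
- by rewrite set0I cards0 (two_used_rank LS ku ku' kk').
- by exists x.
Qed.

End GenericParameters.

(** * Lines whose elements span a hyperplane *)

Section Spanning.
Variables (K : numFieldType) (d n : nat).
Implicit Types (A : 'M[K]_(d, n)) (l : {set 'I_d}) (g h q : 'rV[K]_n).

(** The rows on [l] have rank at least [n.-1], so that a common normal is unique up to a scalar; see
    [spans_parallel]. *)
Definition spans A l := exists T : {set 'I_d}, [/\ T \subset l, #|T|.+1 = n & ~ rowdep A T].

Lemma spans_parallel A l g h q : spans A l -> orth A l g -> orth A l h -> dot h q != 0 ->
  g = (dot g q / dot h q) *: h.
Proof.
move=> [T [Tl Tn indT]] lg lh; apply: (orth_parallel indT); rewrite ?Tn //; exact: orthS Tl _.
Qed.

Lemma zopen_spans_mx (X : lmodType K) (M : X -> 'M[K]_(d, n)) l : fa_mx (@line_poly K X) M ->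
  zopen (fun z => spans (M z) l).
Proof.
move=> CM z [T [Tl Tn indT]]; have [f [Cf fz fP]] := zopen_indep_mx CM indT.
by exists f; split=> // y /fP indTy; exists T.
Qed.

End Spanning.

Section GenericSpanning.
Variables (K : numFieldType) (d n : nat) (L : finType) (D : {set {set 'I_d}}).
Hypothesis LS : line_system n D.
Implicit Types (c : {set 'I_d} -> L) (e : 'I_d) (k : L) (l S T : {set 'I_d}).
Local Notation param := (param K d n L).

Lemma zopen_spans c l : zopen (fun x : param => spans (phi D c x) l).
Proof. exact/zopen_spans_mx/line_poly_phi. Qed.

(** The set [T] of [separated_subset] meets the bounds of [exists_indep]: it has [n.-1] elements and
    lies in no union except that of [c l], so any intersection of two unions misses one of them. *)
Lemma exists_spans c l : separated D c -> l \in D -> exists x : param, spans (phi D c x) l.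
Proof.
move=> sep lD; have [T [Tl Tn Tk]] := separated_subset LS sep lD.
have Tlt : (#|T| < n)%N by rewrite -Tn.
have [|k ku|k k' ku ku' kk'|x [_ indT]] := @exists_indep K d n L D LS c T; last by exists x, T.
- exact: ltnW.
- by apply: leq_ltn_trans Tlt; rewrite subset_leq_card ?subsetIl.
- rewrite -Tn addn2 ltnS; apply: proper_card; rewrite properEneq subsetIl andbT.
  apply/eqP => /setIidPl; rewrite subsetI => /andP[Tsk Tsk'].
  have [ck|ck] := eqVneq (c l) k; last by have := Tk k ku ck; rewrite Tsk.
  by have := Tk k' ku'; rewrite ck Tsk' => /(_ kk').
Qed.

Definition good c (x : param) := np_param D c x /\ forall l, l \in D -> spans (phi D c x) l.

Lemma zopen_good c : zopen (good c).
Proof. by apply: zopenI; [apply: zopen_np_param|apply: zopen_forall => l _; apply: zopen_spans]. Qed.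

Lemma exists_good c : separated D c -> exists x, good c x.
Proof.
move=> sep; have [x xnp] := exists_np_param K LS c.
have [y yP] := zopen_meet_forall (fun l (_ : l \in D) => zopen_spans (l := l))
  (fun l lD => exists_spans sep lD).
have oS : zopen (fun x : param => forall l, l \in D -> spans (phi D c x) l).
  by apply: zopen_forall => l _; apply: zopen_spans.
have [z [znp zs]] := zopen_meet (zopen_np_param (D := D) (c := c)) oS xnp yP.
by exists z.
Qed.

End GenericSpanning.

(** * Quasi-paving matroids *)

Section QuasiPaving.
Variables (K : numFieldType) (d n : nat) (D : {set {set 'I_d}}).
Hypothesis LS : line_system n D.
Variable Q : {set {set {set 'I_d}}}.
Hypothesis QD : partition Q D.
Implicit Types (e : 'I_d) (k : {set {set 'I_d}}) (l S T U H : {set 'I_d}).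
Local Notation c := (pblock Q).
Local Notation Hset := (Hset D (pblock Q)).
Local Notation Hs := [set cover k | k in Q].
Local Notation param := (param K d n {set {set 'I_d}}).

Lemma pblock_label k l : k \in Q -> l \in k -> pblock Q l = k.
Proof. by case/and3P: QD => _ tr _; apply: def_pblock. Qed.

Lemma block_sub k l : k \in Q -> l \in k -> l \in D.
Proof. by move=> kQ lk; rewrite -(cover_partition QD); apply/bigcupP; exists k. Qed.

Lemma used_block k : used D c k <-> k \in Q.
Proof.
split=> [[l lD <-]|kQ]; first by apply: pblock_mem; rewrite (cover_partition QD).
have [l lk] : exists l, l \in k.
  by apply/set0Pn; apply: contraTneq kQ => ->; case/and3P: QD.
by exists l; [apply: block_sub kQ lk|apply: pblock_label].
Qed.

Lemma Hset_cover k : k \in Q -> Hset k = cover k.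
Proof.
move=> kQ; apply/setP => e; rewrite inE; apply/labelsP/bigcupP => [[l [lD el cl]]|[l lk el]].
  by exists l => //; rewrite -cl mem_pblock (cover_partition QD).
by exists l; split=> //; [apply: block_sub kQ lk|apply: pblock_label].
Qed.

Lemma HsP H : reflect (exists2 k, used D c k & H = Hset k) (H \in Hs).
Proof.
apply: (iffP imsetP) => -[k kQ ->]; exists k; rewrite ?Hset_cover //; first exact/used_block.
  exact/used_block.
exact/used_block.
Qed.

Lemma separated_nice : (forall Qi l, Qi \in Q -> l \in D -> l \notin Qi -> ~~ (l \subset cover Qi)) ->
  separated D c.
Proof.
move=> sub l k lD ku cl; have kQ : k \in Q by apply/used_block.
rewrite Hset_cover // sub //; apply: contraNN cl => lk; exact/eqP/pblock_label.
Qed.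

Lemma type1_rowdep A S : forall (x : param), np_param D c x -> A = phi D c x ->
  qp_type1 Hs n S -> rowdep A S.
Proof.
move=> x [_ xnp] ->; case/andP=> /eqP Sn /exists_inP[_ /HsP[k ku ->]].
case/exists_inP=> [_ /HsP[k' ku' ->]] /andP[HH]; rewrite subsetI => /andP[Sk Sk'].
have kk' : k != k' by apply: contraNneq HH => ->.
apply: (orth2_rowdep (xnp k k' ku ku' kk')); rewrite ?Sn //.
  exact/(orthS Sk)/phi_orth.
exact/(orthS Sk')/phi_orth.
Qed.

Lemma dep_rowdep (x : param) S : np_param D c x -> dep_of (MQ_circuits Q n) S ->
  rowdep (phi D c x) S.
Proof.
move=> xnp /exists_inP[C]; rewrite inE => CP CS; apply: (rowdepS CS).
case/or3P: CP => [/(type1_rowdep xnp erefl)//|/and3P[/eqP Cn + _]|/andP[/eqP Cn _]].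
  case/exists_inP=> _ /HsP[k ku ->] Ck; apply: (orth_rowdep (g := normal k x)).
  - by case: xnp => + _; apply.
  - exact/(orthS Ck)/phi_orth.
  - by rewrite Cn.
by apply: card_rowdep; rewrite Cn.
Qed.

Lemma dep_of_type12 S T : T \subset S -> #|T| = n -> (exists2 H, H \in Hs & T \subset H) ->
  dep_of (MQ_circuits Q n) S.
Proof.
move=> TS Tn [H HHs TH].
have [/existsP[U /andP[UT U1]]|no1] := boolP [exists U : {set 'I_d}, (U \subset T) && qp_type1 Hs n U].
  by apply/exists_inP; exists U; rewrite ?inE ?U1 //; apply: subset_trans UT TS.
apply/exists_inP; exists T => //; rewrite inE; apply/or3P/Or32/and3P; split=> //.
  by rewrite Tn.
by apply/exists_inP; exists H.
Qed.

Lemma dep_of_big S : (n < #|S|)%N -> dep_of (MQ_circuits Q n) S.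
Proof.
move=> nS; have [|||T [_ TS Tn]] := @subset_extend _ set0 S n.+1; rewrite ?sub0set ?cards0 //.
have [/existsP[U /andP[UT U12]]|no12] :=
    boolP [exists U : {set 'I_d}, (U \subset T) && (qp_type1 Hs n U || qp_type2 Hs n U)].
  apply/exists_inP; exists U; last exact: subset_trans UT TS.
  by rewrite inE; case/orP: U12 => ->; rewrite ?orbT.
by apply/exists_inP; exists T => //; rewrite inE /qp_type3 Tn eqxx no12 !orbT.
Qed.

Hypothesis sep : separated D c.

(** Type 1 circuits refer to distinct unions as sets, [exists_indep] to distinct labels; separation
    makes the two agree. *)
Lemma Hset_inj k k' : used D c k -> used D c k' -> k != k' -> Hset k != Hset k'.
Proof.
move=> ku [l lD <-] kk'; apply: contraTneq (line_sub_Hset (pblock Q) lD) => <-.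
by apply: sep => //; rewrite eq_sym.
Qed.

(** Failure of a bound of [exists_indep] would exhibit a dependent subset: more than [n] elements,
    [n] elements in one union, or [n.-1] in two unions. *)
Lemma generic_indep S : ~~ dep_of (MQ_circuits Q n) S ->
  exists x : param, ~ rowdep (phi D c x) S.
Proof.
move=> indS; have [|k ku|k k' ku ku' kk'|x [_ xS]] := @exists_indep K d n _ D LS c S; last by exists x.
- by rewrite leqNgt; apply: contra indS; apply: dep_of_big.
- rewrite ltnNge; apply: contra indS => nSk.
  have [|||T [_ TS Tn]] := @subset_extend _ set0 (S :&: Hset k) n; rewrite ?sub0set ?cards0 //.
  move: TS; rewrite subsetI => /andP[TS Tk]; apply: (dep_of_type12 TS Tn).
  by exists (Hset k) => //; apply/HsP; exists k.
- have n2 := two_used_rank LS ku ku' kk'.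
  rewrite addn2; case: n n2 indS => [//|[//|m _]] indS; rewrite !ltnS leqNgt.
  apply: contra indS => mS.
  have [|||T [_ TS Tn]] := @subset_extend _ set0 (S :&: (Hset k :&: Hset k')) m.+1;
    rewrite ?sub0set ?cards0 //.
  move: TS; rewrite subsetI => /andP[TS Tk].
  apply/exists_inP; exists T => //; rewrite inE; apply/or3P/Or31; rewrite /qp_type1 Tn eqxx /=.
  apply/exists_inP; exists (Hset k); first by apply/HsP; exists k.
  apply/exists_inP; exists (Hset k'); first by apply/HsP; exists k'.
  by rewrite Tk Hset_inj.
Qed.

Lemma realization_generic :
  zopen (fun x : param => np_param D c x /\
    forall S, ~~ dep_of (MQ_circuits Q n) S -> ~ rowdep (phi D c x) S) /\
  exists x : param, np_param D c x /\
    forall S, ~~ dep_of (MQ_circuits Q n) S -> ~ rowdep (phi D c x) S.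
Proof.
have oS : zopen (fun x : param => forall S, ~~ dep_of (MQ_circuits Q n) S -> ~ rowdep (phi D c x) S).
  by apply: zopen_forall => S _; apply: zopen_indep.
split; first by apply: zopenI => //; apply: zopen_np_param.
have [x xnp] := exists_np_param K LS c.
have [y yP] := zopen_meet_forall
  (fun S (_ : ~~ dep_of (MQ_circuits Q n) S) => zopen_indep (c := c) (D := D) (S := S) (K := K) (n := n))
  generic_indep.
have [z [znp zS]] := zopen_meet (zopen_np_param (D := D) (c := c)) oS xnp yP.
by exists z.
Qed.

Lemma realization_phi (x : param) : np_param D c x ->
  (forall S, ~~ dep_of (MQ_circuits Q n) S -> ~ rowdep (phi D c x) S) ->
  realization (dep_of (MQ_circuits Q n)) (phi D c x).
Proof.
move=> xnp xS S; split; first exact: dep_rowdep.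
by move=> dS; apply: contrapT => /negP/xS.
Qed.

(** Used to show that normals of different labels are independent at a realization. If a Type 1
    circuit contained [x], then [n] would be at least 3 and the circuit would have another element
    [y], in [T]; tameness at [y] makes [c l] one of the two labels of the circuit, which puts [x]
    into [Hset (c l)]. *)
Lemma indep_subset_line l T x : l \in D -> T \subset l -> #|T|.+1 = n ->
  (forall k, used D c k -> c l != k -> ~~ (T \subset Hset k)) ->
  x \notin Hset (c l) -> ~~ dep_of (MQ_circuits Q n) (x |: T).
Proof.
move=> lD Tl Tn Tk xl; have lu : used D c (c l) by exists l.
have Tcl : T \subset Hset (c l) := subset_trans Tl (line_sub_Hset c lD).
have xT : x \notin T by apply: contra xl; apply: subsetP.
have xTn : #|x |: T| = n by rewrite cardsU1 xT add1n.
apply/exists_inP => -[C]; rewrite inE => CP CS; have Cn := subset_leq_card CS.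
case/or3P: CP => [/andP[/eqP C1 /exists_inP[_ /HsP[k ku ->]]]|/and3P[/eqP C2 + _]|/andP[/eqP C3 _]].
- case/exists_inP=> _ /HsP[k' ku' ->] /andP[/eqP HH]; rewrite subsetI => /andP[Ck Ck'].
  have kk' : k != k' by apply/eqP => kk'; case: HH; rewrite kk'.
  have [xC|xC] := boolP (x \in C).
    have [xk xk'] : x \in Hset k /\ x \in Hset k' by rewrite !(subsetP Ck, subsetP Ck').
    have n3 : (2 < n)%N.
      move: (xk) (xk'); rewrite !inE => /labelsP[l1 [D1 x1 c1]] /labelsP[l2 [D2 x2 c2]].
      have l12 : l1 != l2 by apply: contra_neq kk' => l12; rewrite -c1 l12 c2.
      apply: leq_trans (line_meet LS D1 D2 l12); rewrite addn2 !ltnS.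
      by apply/card_gt0P; exists x; rewrite inE x1.
    have /card_gt0P[y] : (0 < #|C :\ x|)%N.
      by move: n3; rewrite -C1 (cardsD1 x C) xC add1n !ltnS.
    rewrite !inE => /andP[yx yC].
    have yT : y \in T by have := subsetP CS y yC; rewrite !inE (negPf yx).
    have [yk yk'] : y \in Hset k /\ y \in Hset k' by rewrite !(subsetP Ck, subsetP Ck').
    move: yk yk'; rewrite !inE => yk yk'.
    have := labels_tame LS (labels_line (pblock Q) lD (subsetP Tl y yT)) yk yk'.
    by rewrite (negPf kk') orbF => /orP[] /eqP clk; move: xl; rewrite clk ?xk ?xk'.
  have CT : C = T.
    apply/eqP; rewrite eqEcard -ltnS C1 Tn leqnn andbT; apply/subsetP => y yC.
    have := subsetP CS y yC; rewrite !inE => /predU1P[yx|//].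
    by rewrite -yx yC in xC.
  move: Ck Ck'; rewrite CT => Tsk Tsk'.
  have [ck|ck] := eqVneq (c l) k; last by have := Tk k ku ck; rewrite Tsk.
  by have := Tk k' ku'; rewrite ck Tsk' => /(_ kk').
- case/exists_inP=> _ /HsP[k ku ->] Ck.
  have CxT : C = x |: T by apply/eqP; rewrite eqEcard CS xTn C2 leqnn.
  move: Ck; rewrite CxT subUset sub1set => /andP[xk Tk'].
  have [ck|ck] := eqVneq (c l) k; first by move: xl; rewrite ck xk.
  by have := Tk k ku ck; rewrite Tk'.
- by move: Cn; rewrite xTn C3 ltnn.
Qed.

(** Each union has a normal since its [n]-subsets are dependent. If two normals were proportional,
    one hyperplane would contain the independent set of [indep_subset_line] formed from a line of
    one label and a point on a line of the other. *)
Lemma realization_im (A : 'M[K]_(d, n)) : realization (dep_of (MQ_circuits Q n)) A ->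
  exists x : param, phi D c x = A.
Proof.
move=> RA; have /choice[h hP] : forall k, exists h : 'rV[K]_n,
    used D c k -> h != 0 /\ orth A (Hset k) h.
  move=> k; case: (EM (used D c k)) => [ku|nku]; last by exists 0.
  have [T Tk Tn|h hP] := @subsets_rowdep_orth _ _ _ A (Hset k); last by exists h.
  by apply/RA/(@dep_of_type12 T T) => //; exists (Hset k) => //; apply/HsP; exists k.
have [k ku|k k' ku ku' kk'|e k ke|x [xA _]] := @phi_surj K d n _ D LS c A h; last by exists x.
- by case: (hP k ku).
- have [[h0 hk] [h0' hk']] := (hP k ku, hP k' ku').
  apply: contrapT => nnp; have [q] := dot_neq0 h0'; rewrite dotC => hq.
  have hE := not_np nnp (q := q); rewrite hq oner_eq0 in hE; have {}hE := hE isT.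
  have [l lD cl] := ku; have [l' lD' cl'] := ku'.
  have [T [Tl Tn Tk]] := separated_subset LS sep lD.
  have k'k : c l' != k by rewrite cl' eq_sym.
  have [x xl' xk] := subsetPn (sep lD' ku k'k).
  have xcl : x \notin Hset (c l) by rewrite cl.
  apply: (negP (indep_subset_line lD Tl Tn Tk xcl)); apply/RA; apply: (orth_rowdep h0).
    move=> e /setU1P[->|eT]; last first.
      by apply: hk; rewrite -cl; apply: (subsetP (line_sub_Hset (pblock Q) lD)); apply: (subsetP Tl).
    rewrite hE dotZr hk' ?mulr0 // -cl'.
    exact: (subsetP (line_sub_Hset (pblock Q) lD')).
  rewrite cardsU1; case: (boolP (x \in T)) => xT; rewrite /= ?add1n ?Tn //.
  by case/negP: xk; rewrite -cl (subsetP (line_sub_Hset (pblock Q) lD)) ?(subsetP Tl).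
- by have [|_ hk] := hP k; [apply: used_labels ke|apply: hk; rewrite inE].
Qed.

Lemma matroid_varietyE (A : 'M[K]_(d, n)) :
  matroid_variety (dep_of (MQ_circuits Q n)) A <-> variety D c A.
Proof.
split.
  have sub (B : 'M[K]_(d, n)) : realization (dep_of (MQ_circuits Q n)) B -> variety D c B.
    by move=> RB; have [x <-] := realization_im RB; apply: variety_phi.
  exact: (zclosureS sub (A := A)).
have [o ne] := realization_generic.
apply: (dense_variety_sub o ne) => x [xnp xS] p pR; apply: pR.
exact: realization_phi.
Qed.

End QuasiPaving.

(** * Comparison of labelings *)

Section Relabelings.
Variables (K : numFieldType) (d n : nat) (D : {set {set 'I_d}}).
Hypothesis LS : line_system n D.
Local Notation line := {set 'I_d}.
Local Notation label := {set {set 'I_d}}.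

(** Values in an arbitrary type, such as normal vectors, are replaced by their fibres, which leaves
    finitely many labelings to maximize over. *)
Lemma relabel (J : Type) (f : line -> J) : exists c : {ffun line -> label},
  forall l l', l \in D -> l' \in D -> (c l = c l') <-> (f l = f l').
Proof.
exists [ffun l => [set l' in D | `[< f l' = f l >]]] => l l' lD lD'; rewrite !ffunE.
split=> [/setP/(_ l)|->//]; rewrite !inE lD.
by case: asboolP => // _ /esym; case: asboolP.
Qed.

Lemma line_poly_id_mx m p : fa_mx (@line_poly K 'M[K]_(m, p)) id.
Proof. exact: (line_poly_mx_linear idfun). Qed.

Lemma common_nonorth (J : finType) (P : pred J) (h : J -> 'rV[K]_n) :
  (forall j, P j -> h j != 0) -> exists q, forall j, P j -> dot (h j) q != 0.
Proof.
move=> h0; apply: (zopen_meet_forall (O := fun j q => dot (h j) q != 0)) => j Pj.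
  apply: zopen_neq0; apply: (fa_dot (line_poly_algebra _)); last exact: line_poly_id_mx.
  exact: (fa_mx_const (line_poly_algebra _)).
by have [u uh] := dot_neq0 (h0 j Pj); exists u; rewrite dotC uh oner_eq0.
Qed.

(** Scaling the normals so that all pair to 1 with a common [q] makes proportional normals equal;
    the lines are then labeled by their scaled normals. *)
Lemma orth_lines_variety (A : 'M[K]_(d, n)) :
  (forall l, l \in D -> exists h, h != 0 /\ orth A l h) ->
  exists c : {ffun line -> label}, variety D c A.
Proof.
move=> hA; have /choice[h hP] : forall l, exists h : 'rV[K]_n, l \in D -> h != 0 /\ orth A l h.
  by move=> l; have [/hA[h ?]|_] := boolP (l \in D); [exists h|exists 0].
have [|q hq] := common_nonorth (P := mem D) (h := h); first by move=> l /hP[].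
pose g l := (dot (h l) q)^-1 *: h l.
have gq l : l \in D -> dot (g l) q = 1 by move=> lD; rewrite dotZl mulVf // hq.
have [c cP] := relabel g; exists c.
have [l lD|l l' lD lD'|l l' lD lD' cl|l lD|x [<- _]] := @phi_surj_lines K d n _ D LS c A g.
- by apply: contra_eq_neq (gq l lD) => ->; rewrite dot0l eq_sym oner_eq0.
- by move/(cP _ _ lD lD').
- by apply: (np_neq (gq _ lD) (gq _ lD')); apply: contraNneq cl => /(cP _ _ lD lD') ->.
- by move=> e el; have [_ /(_ e el)] := hP l lD; rewrite dotZr => ->; rewrite mulr0.
- exact: variety_phi.
Qed.

Section Label.
Variable L : finType.
Implicit Types (c : line -> L) (k : L) (l : line).

(** In [phi D c x] the line [l] is also orthogonal to the normal of [k]. The sum drops because an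
    element of [l] lies on [l] and on a line labeled [k], hence by tameness on no third line, and so
    loses the label [c l]. *)
Lemma move_line c l k : l \in D -> used D c k -> c l != k -> l \subset Hset D c k ->
  let c' l' := if l' == l then k else c l' in
  (forall A : 'M[K]_(d, n), variety D c A -> variety D c' A) /\
  (\sum_k' #|Hset D c' k'| < \sum_k' #|Hset D c k'|)%N.
Proof.
move=> lD ku ck lk c'; split.
  have [x0 x0P] := exists_np_param K LS c.
  apply: (dense_variety_sub (zopen_np_param (D := D) (c := c))); first by exists x0.
  move=> x [xn0 xnp]; have c'u l' : l' \in D -> used D c (c' l').
    by move=> lD'; rewrite /c'; case: ifP => // _; exists l'.
  have [l' lD'|l1 l2 _ _ ->//|l1 l2 D1 D2|l' lD'|y [<- _]] :=
    @phi_surj_lines K d n _ D LS c' (phi D c x) (fun l' => normal (c' l') x).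
  - exact/xn0/c'u.
  - by move=> c12; apply: xnp => //; apply: c'u.
  - rewrite /c'; case: eqP => [->|_]; last exact: phi_orth_line.
    exact/(orthS lk)/phi_orth.
  - exact: variety_phi.
have sub k' : Hset D c' k' \subset Hset D c k'.
  apply/subsetP => e; rewrite inE => /labelsP[l' [lD' el']].
  rewrite /c'; case: eqP => [l'l <-|_ <-]; first by apply: (subsetP lk); rewrite -l'l.
  by rewrite inE labels_line.
have [e el] : exists e, e \in l.
  by apply/card_gt0P; apply: leq_trans (line_rank LS lD) (line_card LS lD).
rewrite (bigD1 (c l)) //= [X in (_ < X)%N](bigD1 (c l)) //= -addSn leq_add //.
  apply: proper_card; rewrite properE sub; apply/subsetPn; exists e.
    by rewrite inE labels_line.
  have := subsetP lk e el; rewrite !inE => /labelsP[l2 [D2 e2 c2]].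
  apply/labelsP => -[l1 [D1 e1 c1]]; move: c1; rewrite /c'; case: eqP => [_ c1|/eqP l1l c1].
    by rewrite c1 eqxx in ck.
  have := tame_lines LS lD D1 D2 el e1 e2; rewrite eq_sym (negPf l1l) /=.
  by case/orP => /eqP E; move: ck; rewrite -c2; [rewrite E|rewrite -c1 E]; rewrite eqxx.
by apply: leq_sum => k' _; apply: subset_leq_card.
Qed.

Lemma variety_closed c (f : 'M[K]_(d, n) -> K) (O : param K d n L -> Prop) : mpoly_fun f ->
  zopen O -> (exists x, O x) -> (forall x, O x -> f (phi D c x) = 0) ->
  forall A, variety D c A -> f A = 0.
Proof.
move=> [p pf] oO neO f0 A VA; rewrite -pf; apply: VA => _ [x ->].
apply: (line_poly_eq0 (f := fun x => mpeval p (phi D c x)) _ oO neO).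
  exact: line_poly_mpeval.
by move=> z /f0; rewrite pf.
Qed.

(** The vanishing of determinants passes to the closure, where [det_orth] recovers a normal. *)
Lemma variety_orth c k A : used D c k -> variety D c A ->
  exists g : 'rV[K]_n, g != 0 /\ orth A (Hset D c k) g.
Proof.
move=> ku VA; apply: det_orth => f fk; have [x0 x0P] := exists_np_param K LS c.
apply: (variety_closed (mpoly_fun_det K f) (zopen_np_param (D := D) (c := c)) _ _ VA).
  by exists x0.
move=> x [xn0 _]; apply: (orth_det (xn0 k ku) _ fk); apply: phi_orth.
exact: LS.
Qed.

Lemma zopen_not_variety c (L' : finType) (c' : line -> L') :
  zopen (fun x => ~ variety D c (phi D c' x : 'M[K]_(d, n))).
Proof.
move=> x /existsNP[p /not_implyP[p0 /eqP px]].
exists (fun x => mpeval p (phi D c' x)); split=> //; first exact: line_poly_mpeval.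
by move=> y /eqP py; apply/existsNP; exists p; apply/not_implyP.
Qed.

End Label.
End Relabelings.

(** * Deformation along a lift *)

Section Hyperplanes.
Variables (K : numFieldType) (d n : nat).
Implicit Types (A : 'M[K]_(d, n)) (E l S : {set 'I_d}) (g h q : 'rV[K]_n).

Lemma row_rows_in A E e : e \in E -> row e (rows_in A E) = row e A.
Proof. by move=> eE; apply/rowP => j; rewrite !mxE eE. Qed.

Lemma rows_in_orth A E g : orth A E g -> rows_in A E *m g^T = 0.
Proof.
move=> Eg; apply/row_matrixP => e; rewrite row_mul row0.
have [eE|eE] := boolP (e \in E).
  by rewrite row_rows_in //; apply/matrixP => i j; rewrite !ord1 [RHS]mxE; apply: Eg.
suff -> : row e (rows_in A E) = 0 by rewrite mul0mx.
by apply/rowP => j; rewrite !mxE (negPf eE).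
Qed.

Lemma sub_rows_in_orth A E g v : orth A E g -> (v <= rows_in A E)%MS -> dot v g = 0.
Proof.
by move=> /rows_in_orth Eg /submxP[B ->]; rewrite /dot -mulmxA Eg mulmx0 mxE.
Qed.

Lemma subrows_sub A E S : S \subset E -> (subrows S A <= rows_in A E)%MS.
Proof.
move=> SE; apply/row_subP => i; rewrite row_rowsub -(row_rows_in A (E := E)) ?row_sub //.
exact: (subsetP SE) (enum_valP i).
Qed.

Lemma spans_rank A E l h : l \subset E -> spans A l -> h != 0 -> orth A E h ->
  (\rank (rows_in A E)).+1 = n.
Proof.
move=> lE [T [Tl Tn /not_rowdep/eqP rT]] h0 /rows_in_orth/mulmx0_rank_max.
rewrite mxrank_tr rank_rV h0 addn1 => rE; apply/eqP; rewrite eqn_leq rE -{1}Tn ltnS -rT.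
exact/mxrankS/subrows_sub/(subset_trans Tl).
Qed.

Lemma kermx_hyperplane g : g != 0 -> is_hyperplane (kermx g^T).
Proof.
move=> g0; rewrite /is_hyperplane mxrank_ker mxrank_tr rank_rV g0 subn1.
have : (\rank g <= n)%N := rank_leq_col g.
by rewrite rank_rV g0 => n0; rewrite prednK.
Qed.

End Hyperplanes.

Section LiftStep.
Variables (K : numFieldType) (d n : nat) (D : {set {set 'I_d}}).
Hypothesis LS : line_system n D.
Local Notation line := {set 'I_d}.
Local Notation label := {set {set 'I_d}}.
Variable L : finType.
Implicit Types (c : line -> L) (k : L) (l : line).

Definition block c k : {set line} := [set l in D | c l == k].

Lemma cover_block c k : cover (block c k) = Hset D c k.
Proof.
apply/setP => e; rewrite inE; apply/bigcupP/labelsP => [[l]|[l [lD el <-]]].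
  by rewrite inE => /andP[lD /eqP <-] el; exists l.
by exists l => //; rewrite inE lD eqxx.
Qed.

Lemma ML_dep (P : {set line}) l (T : line) : l \in P -> T \subset l -> #|T| = n ->
  dep_of (ML_circuits P n) T.
Proof.
move=> lP Tl Tn; apply/exists_inP; exists T => //; rewrite inE; apply/andP; split.
  by apply: subset_trans Tl (bigcup_sup _ lP).
by rewrite Tn eqxx; apply/orP; left; apply/exists_inP; exists l.
Qed.

Definition lift_rows (A : 'M[K]_(d, n)) (z : 'I_d -> K) q : 'M[K]_(d, n) :=
  \matrix_i (row i A + z i *: q).

Lemma row_lift_rows A z q e : row e (lift_rows A z q) = row e A + z e *: q.
Proof. by rewrite rowK. Qed.

(** If [g] were orthogonal to [q], it would be normal to the original rows, so a multiple of [h], so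
    0. Scaled to [dot g q = 1], it shows that the lift on [l] comes from a linear form. *)
Lemma lift_normal (A : 'M[K]_(d, n)) z q h l : spans A l -> orth A l h -> dot h q != 0 ->
  (exists g : 'rV[K]_n, g != 0 /\ orth (lift_rows A z q) l g) ->
  exists g, dot g q = 1 /\ forall e, e \in l -> dot (row e A) g = - z e.
Proof.
move=> As lh hq [g [g0 lg]].
have gq : dot g q != 0.
  apply: contraNneq g0 => gq; suff gA : orth A l g.
    by rewrite (spans_parallel As gA lh hq) gq mul0r scale0r.
  by move=> e /lg; rewrite row_lift_rows dotDl dotZl (dotC q) gq mulr0 addr0.
exists ((dot g q)^-1 *: g); split; first by rewrite dotZl mulVf.
move=> e /lg; rewrite row_lift_rows dotDl dotZl (dotC q) => /eqP; rewrite addr_eq0 => /eqP eg.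
by rewrite dotZr eg mulrN mulrCA mulVf // mulr1.
Qed.

Section Deformation.
Variables (c : line -> L) (k : L) (x : param K d n L) (q : 'rV[K]_n).
Variables (z : 'I_d -> K) (g : line -> 'rV[K]_n).
Local Notation A := (phi D c x).
Local Notation h := (normal k x).
Local Notation P := (block c k).
Hypothesis xgood : good D c x.
Hypothesis ku : used D c k.
Hypothesis qh : dot h q = 1.
Hypothesis gq : forall l, l \in P -> dot (g l) q = 1.
Hypothesis gA : forall l e, l \in P -> e \in l -> dot (row e A) (g l) = - z e.

(** On the block, the pencil from [h] at [t = 0] to [g l] at [t = 1]; all its members pair to 1 with
    [q] and are therefore nonzero. *)
Definition hcurve l (t : K^o) : 'rV[K]_n :=
  if l \in P then h + (t : K) *: (g l - h) else normal (c l) x.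

Lemma inP l : (l \in P) = (l \in D) && (c l == k).
Proof. by rewrite inE. Qed.

Lemma line_poly_hcurve l : fa_mx (@line_poly K K^o) (hcurve l).
Proof.
have CA := line_poly_algebra K^o; rewrite /hcurve; case: (l \in block c k); last exact: fa_mx_const.
apply: (fa_mx_add CA); first exact: fa_mx_const.
apply: (fa_mx_scale CA); last exact: fa_mx_const.
exact: (line_poly_linear idfun).
Qed.

Lemma hcurve_dot l t : l \in P -> dot (hcurve l t) q = 1.
Proof. by move=> lP; rewrite /hcurve lP dotDl dotZl dotBl gq // qh subrr mulr0 addr0. Qed.

Lemma hcurve0 l : l \in D -> hcurve l 0 = normal (c l) x.
Proof.
by move=> lD; rewrite /hcurve inP lD /=; case: eqP => [->|//]; rewrite scale0r addr0.
Qed.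

(* Each e in the block moves inside the hyperplane of one of its lines, in a direction r that
   keeps it on the hyperplanes of the other labels; r = q when there is none. *)
Lemma deformation_direction : exists F : 'I_d -> line * 'rV[K]_n, forall e, e \in Hset D c k ->
  [/\ (F e).1 \in P, e \in (F e).1, dot (F e).2 h = 1,
      forall k', k' \in labels D c e -> k' != k -> dot (F e).2 (normal k' x) = 0 &
      (forall k', k' \in labels D c e -> k' = k) -> (F e).2 = q].
Proof.
case: xgood => -[xn0 xnp] _.
suff /choice[F FP] : forall e, exists F : line * 'rV[K]_n, e \in Hset D c k ->
  [/\ F.1 \in P, e \in F.1, dot F.2 h = 1,
      forall k', k' \in labels D c e -> k' != k -> dot F.2 (normal k' x) = 0 &
      (forall k', k' \in labels D c e -> k' = k) -> F.2 = q] by exists F.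
move=> e; have [ek|_] := boolP (e \in Hset D c k); last by exists (set0, 0).
have := ek; rewrite inE => /labelsP[l [lD el cl]].
have lP : l \in P by rewrite inP lD cl eqxx.
case: (EM (exists2 k', k' \in labels D c e & k' != k)) => [[k' ek' kk']|nk'].
  have [r [rk' rk]] := np_dual (xnp k' k (used_labels ek') ku kk').
  exists (l, r) => _; split=> //= [k2 ek2 kk2|/(_ _ ek') kE].
    have := ek; rewrite inE => ek0; have := labels_tame LS ek0 ek' ek2.
    by rewrite !(eq_sym k) (negPf kk') (negPf kk2) /= => /eqP <-.
  by rewrite kE eqxx in kk'.
exists (l, q) => _; split=> //=; first by rewrite dotC.
by move=> k' ek' kk'; case: nk'; exists k'.
Qed.

Lemma deformation : exists M : K^o -> 'M[K]_(d, n),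
  [/\ fa_mx (@line_poly K K^o) M, M 0 = A & forall t l, l \in D -> orth (M t) l (hcurve l t)].
Proof.
have [F FP] := deformation_direction.
pose M (t : K^o) : 'M[K]_(d, n) := \matrix_e
  (if e \in Hset D c k then psi (hcurve (F e).1 t) (F e).2 (row e A) else row e A).
have ortA e k' : k' \in labels D c e -> dot (row e A) (normal k' x) = 0 by apply: phi_orth_label.
have CA := line_poly_algebra K^o.
exists M; split.
- suff H e : fa_mx (@line_poly K K^o) (fun t => if e \in Hset D c k
      then psi (hcurve (F e).1 t) (F e).2 (row e A) else row e A).
    by move=> e j; apply: (fa_ext CA) (H e 0 j) => t; rewrite mxE.
  case: (e \in Hset D c k); last exact: fa_mx_const.
  by apply: (fa_psi CA); [apply: line_poly_hcurve|apply: fa_mx_const..].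
- apply/row_matrixP => e; rewrite rowK; case: ifP => // eE.
  have [lP el rh _ _] := FP e eE; move: (lP); rewrite inP => /andP[lD /eqP cl].
  by rewrite psi_id // hcurve0 // cl // ortA // -cl labels_line.
- move=> t l lD e el; rewrite rowK; have [lP|lP] := boolP (l \in P); last first.
    have clk : c l != k by move: lP; rewrite inP lD.
    have ecl : c l \in labels D c e := labels_line c lD el.
    rewrite /hcurve (negPf lP); case: ifP => eE; last exact: ortA.
    by have [_ _ _ rh _] := FP e eE; apply: dot_psi_orth; [apply: rh|apply: ortA].
  have cl : c l = k by move: lP; rewrite inP lD /= => /eqP.
  have eE : e \in Hset D c k by rewrite -cl inE labels_line.
  rewrite eE; have [l1P el1 rh rk rq] := FP e eE.
  have [l1l|l1l] := eqVneq (F e).1 l; first by rewrite l1l dot_psi.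
  (* Here [e] lies on two lines of the block, so by tameness it has no other label and moves along
     [q]. The two pencils pair equally with [q] and, by [gA], with row [e] of [A]; projecting to one
     hyperplane therefore lands in the other. *)
  have rE : (F e).2 = q.
    apply: rq => k' /labelsP[l2 [D2 el2 <-]].
    move: l1P; rewrite inP => /andP[D1 /eqP cl1].
    by case/or3P: (tame_lines LS D1 lD D2 el1 el el2) l1l => /eqP E; rewrite -?E ?eqxx.
  rewrite rE /psi !dot_linear ?(dotC q) !hcurve_dot // mulr1 mul1r /hcurve l1P lP !dot_linear !gA //.
  by rewrite ortA ?subrr // -cl labels_line.
Qed.

(** The labeling [c'] refines [c] by the forms [g l] within the block. The deformed matrix lies in
    V_c' for generic [t], hence also at [t = 0]; generically it leaves V_c, since [l1] and [l2] then
    span hyperplanes with independent normals. *)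
Lemma deformed_variety l1 l2 : l1 \in P -> l2 \in P -> g l1 != g l2 ->
  exists c' : {ffun line -> label}, variety D c' A /\
    exists B : 'M[K]_(d, n), variety D c' B /\ ~ variety D c B.
Proof.
move=> l1P l2P g12; have [M [CM M0 MO]] := deformation.
have [[xn0 xnp] xs] := xgood.
have [c' c'P] := relabel D (fun l => (c l, if l \in P then g l else 0)).
have c'E l l' : l \in D -> l' \in D -> c' l = c' l' -> forall t, hcurve l t = hcurve l' t.
  move=> lD lD' /(c'P _ _ lD lD')[cl gl] t; rewrite /hcurve; move: gl; rewrite !inP lD lD' -cl /=.
  by case: eqP => // _ ->.
have c'N l l' : l \in D -> l' \in D -> c' l != c' l' -> exists t, np (hcurve l t) (hcurve l' t).
  move=> lD lD' cN; have [cl|cl] := eqVneq (c l) (c l').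
    have : g l != g l' /\ c l = k.
      have [ck|ck] := eqVneq (c l) k; last first.
        case/eqP: cN; apply/(c'P _ _ lD lD'); congr (_, _) => //.
        by rewrite !inP lD lD' -cl (negPf ck).
      split=> //; apply: contraNneq cN => gE; apply/eqP/(c'P _ _ lD lD').
      by rewrite !inP lD lD' -cl gE.
    case=> gN ck; have lP : l \in P by rewrite inP lD ck eqxx.
    have lP' : l' \in P by rewrite inP lD' -cl ck eqxx.
    (* At [t = 1] the curves reach [g l] and [g l'], distinct and both pairing to 1 with [q]. Lines
       with different labels under [c] are already told apart at [t = 0]. *)
    exists 1; apply: (np_neq (q := q)); rewrite ?hcurve_dot //.
    by rewrite /hcurve lP lP' !scale1r !(addrC h) !subrK.
  by exists 0; rewrite !hcurve0 //; apply: xnp => //; [exists l|exists l'].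
pose O (t : K^o) := forall ll : line * line, [/\ ll.1 \in D, ll.2 \in D & c' ll.1 != c' ll.2] ->
  np (hcurve ll.1 t) (hcurve ll.2 t).
have oP (ll : line * line) : zopen (fun t => np (hcurve ll.1 t) (hcurve ll.2 t)).
  apply: zopen_row_free; apply: (fa_mx_col_mx (line_poly_algebra K^o)); exact: line_poly_hcurve.
have oO : zopen O by apply: zopen_forall => ll _; apply: oP.
have neO : exists t, O t.
  by apply: zopen_meet_forall => [ll _|ll [D1 D2 c12]]; [apply: oP|apply: c'N].
have inV t : O t -> variety D c' (M t).
  move=> Ot; have [l lD|l l' lD lD' cE|l l' lD lD' cN|l lD|y [<- _]] :=
    @phi_surj_lines K d n _ D LS c' (M t) (hcurve^~ t); last exact: variety_phi.
  - have [lP|lP] := boolP (l \in P).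
      by apply: contra_eq_neq (hcurve_dot t lP) => ->; rewrite dot0l eq_sym oner_eq0.
    by rewrite /hcurve (negPf lP); apply: xn0; exists l.
  - exact: c'E.
  - exact: (Ot (l, l')).
  - exact: MO.
exists c'; split.
  move=> p p0; rewrite -M0.
  apply: (line_poly_eq0 (f := fun t => mpeval p (M t)) _ oO neO).
    exact: (fa_mpeval (line_poly_algebra K^o)).
  by move=> t /inV; apply.
have [D1 D2] : l1 \in D /\ l2 \in D by move: l1P l2P; rewrite !inP => /andP[-> _] /andP[-> _].
have oS : zopen (fun t => spans (M t) l1 /\ spans (M t) l2).
  by apply: zopenI; apply: zopen_spans_mx.
have [t0 Ot0] := neO.
have [|t [Ot [s1 s2]]] := zopen_meet oO oS Ot0 (_ : spans (M 0) l1 /\ spans (M 0) l2).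
  by rewrite M0; split; apply: xs.
exists (M t); split; first exact: inV.
move=> VM; have [g0 [g0N g0O]] := variety_orth LS ku VM.
have lk l : l \in P -> l \subset Hset D c k.
  by rewrite inP => /andP[lD /eqP <-]; apply: line_sub_Hset.
have par l : l \in P -> spans (M t) l -> g0 = dot g0 q *: hcurve l t.
  move=> lP sl; have lD : l \in D by move: lP; rewrite inP => /andP[].
  have := spans_parallel sl (orthS (lk l lP) g0O) (MO t l lD) (q := q).
  by rewrite hcurve_dot // oner_eq0 divr1; apply.
have np12 : np (hcurve l1 t) (hcurve l2 t).
  apply: (Ot (l1, l2)); split=> //=; apply: contraNneq g12 => /(c'P _ _ D1 D2)[_].
  by rewrite l1P l2P => ->.
have := npP _ _ np12 (dot g0 q) (- dot g0 q).
rewrite scaleNr -!par // subrr => /(_ erefl)[g0q _].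
by move: g0N; rewrite (par l1) // g0q scale0r eqxx.
Qed.

End Deformation.

(** The labeling from [deformed_variety] depends on the point. If none worked for the whole variety,
    a good point could be chosen outside V_c' for each of the finitely many [c'] with V_c' not
    inside V_c, and the deformation at that point gives a contradiction. *)
Lemma lift_step c k : separated D c -> used D c k ->
  liftable K n (cover (block c k)) (dep_of (ML_circuits (block c k) n)) ->
  exists c' : {ffun line -> label},
    (forall A : 'M[K]_(d, n), variety D c A -> variety D c' A) /\
    exists A : 'M[K]_(d, n), variety D c' A /\ ~ variety D c A.
Proof.
move=> sep ku lft; apply: contrapT => noc'.
pose bad (c' : {ffun line -> label}) := exists A : 'M[K]_(d, n), variety D c' A /\ ~ variety D c A.
pose O (c' : {ffun line -> label}) (x : param K d n L) := ~ variety D c' (phi D c x).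
have [c' bc'|c' bc'|y yP] := @zopen_meet_forall K _ _ bad O.
- exact: zopen_not_variety.
- apply: contrapT => nO; apply: noc'; exists c'; split=> //.
  apply: zclosureS => _ [x ->]; apply: contrapT => nx; apply: nO; by exists x.
have oO : zopen (fun x => forall c' : {ffun line -> label}, bad c' -> O c' x).
  by apply: zopen_forall => c' _; apply: zopen_not_variety.
have [x0 x0g] := exists_good K LS sep.
have [x [xg xO]] := zopen_meet (zopen_good (c := c) (D := D)) oO x0g yP.
suff [c' [Vc' bc']] : exists c' : {ffun line -> label}, variety D c' (phi D c x) /\ bad c'.
  exact: (xO c' bc').
have [[xn0 xnp] xs] := xg; have [q qh] := dot_neq0 (xn0 k ku); rewrite dotC in qh.
have [l0 lD0 cl0] := ku; have l0P : l0 \in block c k by rewrite inE lD0 cl0 eqxx.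
set E := cover _ in lft; have EE : E = Hset D c k := cover_block c k.
have lE l : l \in block c k -> l \subset E by move=> lP; apply: bigcup_sup.
have Eh : orth (phi D c x) E (normal k x) by rewrite EE; apply: phi_orth.
have [|||z [zdep zspan]] := lft (phi D c x) <<rows_in (phi D c x) E>>%MS q.
- by rewrite /is_hyperplane mxrank_gen (spans_rank (lE _ l0P) (xs _ lD0) (xn0 k ku) Eh).
- by rewrite !genmxE submx_refl.
- rewrite genmxE; apply/negP => /(sub_rows_in_orth Eh)/eqP.
  by rewrite dotC qh oner_eq0.
have hq : dot (normal k x) q != 0 by rewrite qh oner_eq0.
have /choice[g gP] : forall l, exists g : 'rV[K]_n, l \in block c k ->
    dot g q = 1 /\ forall e, e \in l -> dot (row e (phi D c x)) g = - z e.
  move=> l; have [lP|_] := boolP (l \in block c k); last by exists 0.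
  have lD : l \in D by move: lP; rewrite inE => /andP[].
  have [|g gP] := @lift_normal (phi D c x) z q (normal k x) l (xs l lD) (orthS (lE l lP) Eh) hq.
    apply: subsets_rowdep_orth => T Tl Tn; apply: zdep; first exact: subset_trans Tl (lE l lP).
    exact: ML_dep Tl Tn.
  by exists g.
(* If all normals agreed, the lifted block would lie in one hyperplane, against [zspan]. *)
have [|/forallPn/existsP nall] := boolP [forall l in block c k, g l == g l0].
  move=> /forall_inP allg; case: zspan; exists (kermx (g l0)^T).
    apply: kermx_hyperplane; have [g0 _] := gP _ l0P.
    by apply: contra_eq_neq g0 => ->; rewrite dot0l eq_sym oner_eq0.
  move=> e /bigcupP[l lP el]; apply/sub_kermxP/matrixP => i j; rewrite !ord1 [RHS]mxE.
  rewrite -[LHS]/(dot _ _) rowK -(eqP (allg l lP)); have [gq geq] := gP l lP.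
  by rewrite dotDl dotZl (dotC q) gq geq // mulr1 addNr.
have [l1] := existsP nall; rewrite negb_imply => /andP[l1P g10].
apply: (deformed_variety (q := q) (z := z) xg ku qh _ _ l1P l0P g10).
  by move=> l /gP[].
by move=> l e /gP[_ +] el => /(_ e el).
Qed.

End LiftStep.

(** * Paving matroids and maximal labelings *)

Section PavingMatroid.
Variables (d n : nat) (I : {set {set 'I_d}}).
Hypotheses (MI : is_matroid I) (PI : paving I n) (TI : tame I n).
Implicit Types (S T H l : {set 'I_d}).

Lemma exists_circuit S : S \notin I -> exists2 C : {set 'I_d}, is_circuit I C & C \subset S.
Proof.
move=> SI; have [C /minsetP[CI Cmin] CS] := minset_exists (P := fun A => A \notin I) SI.
exists C => //; rewrite /is_circuit CI; apply/forall_inP => x xC; apply: contraT => xI.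
by have := Cmin _ xI (subD1set C x) => /setP/(_ x); rewrite !inE eqxx xC.
Qed.

Lemma dep_card S : S \notin I -> (n <= #|S|)%N.
Proof.
case/exists_circuit => C /PI Cn /subset_leq_card; apply: leq_trans.
by case: Cn => ->.
Qed.

Lemma dep_circuit S : S \notin I -> #|S| = n -> is_circuit I S.
Proof.
move=> SI Sn; have [C Cc CS] := exists_circuit SI.
suff -> : S = C by [].
apply/eqP; rewrite eq_sym eqEcard CS Sn; apply: dep_card.
by case/andP: Cc.
Qed.

Lemma n_circ_setP H :
  reflect ((n <= #|H|)%N /\ forall S, S \subset H -> #|S| = n -> S \notin I) (n_circ_set I n H).
Proof.
apply: (iffP andP) => -[nH HS]; split=> //.
  move=> S SH Sn; have /forallP/(_ S) := HS.
  by rewrite SH Sn eqxx => /andP[].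
apply/forallP => S; apply/implyP => /andP[SH /eqP Sn].
by apply: dep_circuit => //; apply: HS.
Qed.

Lemma dep_hyp_circ l : l \in dep_hyps I n -> n_circ_set I n l.
Proof. by rewrite inE => /andP[]. Qed.

Lemma dep_hyp_max l H : l \in dep_hyps I n -> n_circ_set I n H -> l \subset H -> H = l.
Proof.
by rewrite inE => /andP[_ /forallP/(_ H)] + Hc lH; rewrite lH Hc => /eqP.
Qed.

Lemma dep_hyp_dep l T : l \in dep_hyps I n -> T \subset l -> #|T| = n -> T \notin I.
Proof. by move=> /dep_hyp_circ/n_circ_setP[_]; apply. Qed.

Lemma dep_sub_hyp S : S \notin I -> #|S| = n -> exists2 l, l \in dep_hyps I n & S \subset l.
Proof.
move=> SI Sn; have Sc : n_circ_set I n S.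
  apply/n_circ_setP; rewrite Sn; split=> // T TS Tn.
  suff -> : T = S by [].
  by apply/eqP; rewrite eqEcard TS Sn Tn leqnn.
have [l /maxsetP[lc lmax] Sl] := maxset_exists (P := n_circ_set I n) Sc.
exists l => //; rewrite inE /dep_hyp lc; apply/forallP => H; apply/implyP => /andP[lH Hc].
exact/eqP/lmax.
Qed.

(** Two lines sharing a set [T] of size [n.-1] coincide: [T] is independent, and an independent
    [n]-subset of the union would augment [T] within one of the lines. So all [n]-subsets of the
    union are circuits, and maximality applies to both lines. *)
Lemma paving_line_system : line_system n (dep_hyps I n).
Proof.
have pos l : l \in dep_hyps I n -> (0 < n)%N.
  move=> lD; rewrite lt0n; apply/eqP => n0.
  have [I0 _ _] := MI.
  by have := dep_hyp_dep lD (sub0set l); rewrite cards0 n0 I0 => /(_ erefl).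
split=> //; first by move=> l /dep_hyp_circ/n_circ_setP[].
move=> l l' lD lD' ll'; rewrite addn2 leqNgt; apply: contra ll'; rewrite ltnS => nl.
have [||| T [_ + Tn]] := @subset_extend _ set0 (l :&: l') n.-1; rewrite ?sub0set ?cards0 //.
  by rewrite -ltnS prednK ?(pos l).
rewrite subsetI => /andP[Tl Tl'].
have TI' : T \in I.
  by apply: contraT => /dep_card; rewrite Tn -ltnS prednK ?(pos l) // ltnn.
have uc : n_circ_set I n (l :|: l').
  apply/n_circ_setP; split.
    by apply: leq_trans (subset_leq_card (subsetUl l l')); case/n_circ_setP: (dep_hyp_circ lD).
  move=> S Sll Sn; apply/negP => SI; have [_ _ aug] := MI.
  have [|x /setDP[xS xT] xTI] := aug T S TI' SI; first by rewrite Sn Tn prednK ?(pos l).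
  have xTn : #|x |: T| = n by rewrite cardsU1 xT Tn add1n prednK ?(pos l).
  have /setUP[xl|xl] := subsetP Sll x xS.
    by have := dep_hyp_dep lD _ xTn; rewrite subUset sub1set xl Tl xTI => /(_ isT).
  by have := dep_hyp_dep lD' _ xTn; rewrite subUset sub1set xl Tl' xTI => /(_ isT).
by rewrite -(dep_hyp_max lD uc) ?subsetUl // (dep_hyp_max lD' uc) ?subsetUr.
Qed.

(** A dependent set with more than [n] elements imposes nothing, and one with [n] elements lies in a
    dependent hyperplane. *)
Lemma circuit_varietyP (K : fieldType) (A : 'M[K]_(d, n)) :
  circuit_variety (fun S => S \notin I) A <->
  forall l, l \in dep_hyps I n -> exists h, h != 0 /\ orth A l h.
Proof.
split=> [CA l lD|hA S SI].
  by apply: subsets_rowdep_orth => T Tl Tn; apply: CA; apply: dep_hyp_dep Tl Tn.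
have := dep_card SI; rewrite leq_eqVlt => /predU1P[Sn|]; last exact: card_rowdep.
have [l lD Sl] := dep_sub_hyp SI (esym Sn); have [h [h0 lh]] := hA l lD.
by apply: orth_rowdep h0 (orthS Sl lh) _; rewrite -Sn.
Qed.

End PavingMatroid.

(** * Maximal labelings are nice *)

Section MaximalLabeling.
Variables (K : numFieldType) (d n : nat) (D : {set {set 'I_d}}).
Hypothesis LS : line_system n D.
Local Notation line := {set 'I_d}.
Local Notation label := {set {set 'I_d}}.

Lemma variety_kernel (L L' : finType) (c : line -> L) (c' : line -> L') :
  (forall l l', l \in D -> l' \in D -> (c l = c l') <-> (c' l = c' l')) ->
  forall A : 'M[K]_(d, n), variety D c A -> variety D c' A.
Proof.
move=> cc'; have [x0 x0P] := exists_np_param K LS c.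
apply: (dense_variety_sub (zopen_np_param (D := D) (c := c))); first by exists x0.
move=> x [xn0 xnp].
have [l lD|l l' lD lD' cl|l l' lD lD' cl|l lD|y [<- _]] :=
  @phi_surj_lines K d n _ D LS c' (phi D c x) (fun l => normal (c l) x).
- by apply: xn0; exists l.
- by rewrite (cc' _ _ lD lD').2.
- apply: xnp; [by exists l|by exists l'|].
  by apply: contra_neq cl => /(cc' _ _ lD lD').
- exact: phi_orth_line.
- exact: variety_phi.
Qed.

Lemma maximal_labeling (A : 'M[K]_(d, n)) (c0 : {ffun line -> label}) : variety D c0 A ->
  exists c : {ffun line -> label}, [/\ variety D c A, separated D c &
    forall k, used D c k -> ~ liftable K n (cover (block D c k)) (dep_of (ML_circuits (block D c k) n))].
Proof.
move=> c0A; pose V (c : {ffun line -> label}) (B : 'M[K]_(d, n)) := variety D c B.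
(* [N c] counts the labelings whose variety lies in V_c: it is monotone under inclusion of
   varieties, strictly under strict inclusion. *)
pose N c := #|[set c' : {ffun line -> label} | `[< forall B, V c' B -> V c B >]]|.
pose s (c : {ffun line -> label}) := (\sum_k #|Hset D c k|)%N.
pose B := (\sum_(k : label) d)%N.
have sB c : (s c <= B)%N.
  by apply: leq_sum => k _; rewrite -[X in (_ <= X)%N]card_ord max_card.
(* Lexicographic comparison in one number, large [N c] first and then small [s c]: the factor [B.+1]
   exceeds every [B - s c]. *)
pose key c := (N c * B.+1 + (B - s c))%N.
have NS (c c' : {ffun line -> label}) : (forall B, V c B -> V c' B) -> (N c <= N c')%N.
  move=> cc'; apply: subset_leq_card; apply/subsetP => c2; rewrite !inE => /asboolP c2c.
  by apply/asboolP => M /c2c/cc'.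
have [|c /asboolP cA cmax] := @arg_maxnP _ c0 (fun c => `[< V c A >]) key.
  exact/asboolP.
have {}cmax (c' : {ffun line -> label}) : V c' A -> ~ (key c < key c')%N.
  by move=> /asboolP/cmax H; apply/negP; rewrite -leqNgt.
have sep : separated D c.
  move=> l k lD ku ck; apply/negP => lk.
  have [Vc' sc'] := move_line K LS lD ku ck lk.
  pose c' : {ffun line -> label} := [ffun l' => if l' == l then k else c l'].
  have c'E : (c' : line -> label) = fun l' => if l' == l then k else c l'.
    by apply: funext => l'; rewrite ffunE.
  have c'A : V c' A by rewrite /V c'E; apply: Vc'.
  apply: (cmax c' c'A); rewrite /key -addnS leq_add //.
    by rewrite leq_mul2r NS ?orbT // => M; rewrite /V c'E; apply: Vc'.
  have sc'' : (s c' < s c)%N by rewrite /s c'E.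
  by rewrite ltn_sub2l // (leq_trans sc'').
exists c; split=> // k ku lft.
have [c' [Vc' [M [c'M cM]]]] := lift_step LS sep ku lft.
apply: (cmax c' (Vc' _ cA)); rewrite /key.
have NN : (N c < N c')%N.
  apply: proper_card; rewrite properE; apply/andP; split.
    by apply/subsetP => c2; rewrite !inE => /asboolP c2c; apply/asboolP => M' /c2c/Vc'.
  apply/subsetPn; exists c'; rewrite inE; first exact/asboolP.
  by apply/negP => /asboolP/(_ M c'M).
apply: leq_trans (leq_addr _ _); apply: leq_trans (leq_mul NN (leqnn _)).
by rewrite mulSn addnC addSn ltnS leq_add2r leq_subr.
Qed.

Lemma nice_of_labeling (c : {ffun line -> label}) : separated D c ->
  (forall k, used D c k -> ~ liftable K n (cover (block D c k)) (dep_of (ML_circuits (block D c k) n))) ->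
  exists Q : {set {set line}}, [/\ partition Q D,
      (forall Qi, Qi \in Q -> (1 < #|Qi|)%N -> ~ liftable K n (cover Qi) (dep_of (ML_circuits Qi n))),
      (forall Qi l, Qi \in Q -> l \in D -> l \notin Qi -> ~~ (l \subset cover Qi)) &
      forall A : 'M[K]_(d, n), variety D c A -> variety D (pblock Q) A].
Proof.
move=> sep nl; pose Q := preim_partition c D.
have QD : partition Q D := preim_partitionP c D.
have QP Qi : Qi \in Q -> exists2 l, l \in D & Qi = block D c (c l).
  by case/imsetP => l lD ->; exists l => //; apply/setP => l'; rewrite !inE eq_sym.
have blQ l : l \in D -> block D c (c l) \in Q.
  by move=> lD; apply/imsetP; exists l => //; apply/setP => l'; rewrite !inE eq_sym.
exists Q; split=> //.
- by move=> _ /QP[l lD ->] _; apply: nl; exists l.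
- move=> _ l' /QP[l lD ->] lD'; rewrite inE lD' /= cover_block => cl.
  by apply: sep => //; exists l.
- apply: variety_kernel => l l' lD lD'.
  have pE m : m \in D -> pblock Q m = block D c (c m).
    by move=> mD; apply: (pblock_label QD (blQ _ mD)); rewrite inE mD eqxx.
  rewrite !pE //; split=> [->//|/setP/(_ l)].
  by rewrite !inE lD eqxx => /esym/eqP.
Qed.

End MaximalLabeling.

(** * Irredundance *)

Section RankOneUpdate.
Variables (K : numFieldType) (m : nat).

Lemma det_block_schur (M : 'M[K]_m) (z : 'cV_m) (q : 'rV_m) :
  \det (block_mx 1%:M (- q) z M) = \det (M + z *m q).
Proof.
have -> : block_mx 1%:M (- q) z M = block_mx 1%:M 0 z 1%:M *m block_mx 1%:M (- q) 0 (M + z *m q).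
  rewrite mulmx_block !mul1mx !mul0mx !mulmx1 ?mulmx0 ?addr0 ?add0r mulmxN.
  by rewrite addrC addrK.
by rewrite det_mulmx det_lblock det_ublock !det1 !mul1r.
Qed.

Lemma fa_adj X (C : (X -> K) -> Prop) (M : X -> 'M[K]_m) : function_algebra C ->
  fa_mx C M -> fa_mx C (fun x => \adj (M x)).
Proof.
move=> CA CM i j; apply: (fa_ext CA) (_ : C (fun x => cofactor (M x) j i)) => [x|].
  by rewrite mxE.
apply: (fa_mul CA (fa_const CA _)); apply: (fa_det CA) => a b.
by apply: (fa_ext CA) (CM (lift j a) (lift i b)) => x; rewrite !mxE.
Qed.

(* Both sides are polynomial in M, so it suffices to treat invertible M. *)
Lemma det_rank1_update (M : 'M[K]_m) (z : 'cV_m) (q : 'rV_m) :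
  \det (M + z *m q) = \det M + (q *m \adj M *m z) 0 0.
Proof.
have CA := line_poly_algebra 'M[K]_m.
have idM : fa_mx (@line_poly K 'M[K]_m) id by apply: (line_poly_mx_linear idfun).
apply/eqP; rewrite -subr_eq0; apply/eqP.
apply: (line_poly_eq0 (f := fun M => \det (M + z *m q) - (\det M + (q *m \adj M *m z) 0 0))
  (O := fun M => \det M != 0)).
- apply: (fa_add CA); first by apply: (fa_det CA); apply: (fa_mx_add CA) => //; apply: fa_mx_const.
  apply: (fa_opp CA); apply: (fa_add CA); first exact: (fa_det CA).
  apply: (fa_mx_mul CA); last exact: fa_mx_const.
  by apply: (fa_mx_mul CA); [apply: fa_mx_const|apply: (fa_adj CA)].
- by apply: zopen_neq0; apply: (fa_det CA).
- by exists 1%:M; rewrite det1 oner_eq0.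
move=> {}M M0; have uM : M \in unitmx by rewrite unitmxE unitfE.
have -> : M + z *m q = (1%:M + z *m (q *m invmx M)) *m M.
  by rewrite mulmxDl mul1mx -!mulmxA mulVmx // mulmx1.
rewrite det_mulmx -det_block_schur.
(* The other triangular factorization of the matrix of [det_block_schur]. *)
have -> : block_mx 1%:M (- (q *m invmx M)) z 1%:M =
    block_mx (1%:M + q *m invmx M *m z) (- (q *m invmx M)) 0 1%:M *m block_mx 1%:M 0 z (1%:M : 'M_m).
  rewrite mulmx_block !mul1mx ?mul0mx !mulmx1 ?mulmx0 ?add0r ?addr0 mulNmx.
  by rewrite addrK.
rewrite det_mulmx det_lblock det_ublock !det1 !mulr1 det_mx11 /invmx uM -scalemxAr -scalemxAl.
move: (q *m _ *m z) => Y; rewrite !mxE eqxx mulrDl mul1r.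
by rewrite mulrAC mulVf // mul1r subrr.
Qed.

End RankOneUpdate.

Section RowSpans.
Variables (K : numFieldType) (d n : nat).
Implicit Types (A B : 'M[K]_(d, n)) (E S : {set 'I_d}).

Lemma eq_rows_rowdep A B S : (forall e, e \in S -> row e A = row e B) -> rowdep A S -> rowdep B S.
Proof.
move=> AB [c [cN cS c0]]; exists c; split=> //; rewrite -[RHS]c0; apply: eq_bigr => i _.
by have [/AB->//|/cS->] := boolP (i \in S); rewrite !scale0r.
Qed.

Lemma eq_rows_spans A B S : (forall e, e \in S -> row e A = row e B) -> spans A S -> spans B S.
Proof.
move=> AB [T [TS Tn indT]]; exists T; split=> // BT; apply/indT/(eq_rows_rowdep _ BT) => e eT.
by rewrite AB // (subsetP TS).
Qed.

Lemma rank_spans A E : (\rank (rows_in A E)).+1 = n -> spans A E.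
Proof.
move=> rE; set M := rows_in A E in rE.
have free : row_free (rowsub (maxrankfun M) M) := maxrowsub_free M.
have inE i : maxrankfun M i \in E.
  apply: contraT => iE; have := row_free0P _ free (delta_mx 0 i).
  rewrite -rowE row_rowsub => H; have : delta_mx 0 i = 0 :> 'rV[K]_(\rank M).
    by apply: H; apply/rowP => j; rewrite !mxE (negPf iE).
  by move/rowP/(_ i)/eqP; rewrite !mxE !eqxx oner_eq0.
have finj : injective (maxrankfun M) by apply: maxrankfun_inj.
exists [set maxrankfun M i | i in 'I_(\rank M)]; split.
- by apply/subsetP => _ /imsetP[i _ ->].
- by rewrite card_imset // card_ord.
move=> [c [[_ /imsetP[i _ ->] ci] cS c0]].
suff : (\row_j c (maxrankfun M j)) *m rowsub (maxrankfun M) M = 0.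
  by move/(row_free0P _ free)/rowP/(_ i); rewrite !mxE => ci0; rewrite ci0 eqxx in ci.
rewrite -[RHS]c0 mulmx_sum_row [RHS](bigID (fun e => e \in [set maxrankfun M i | i in 'I_(\rank M)])) /=.
rewrite [X in _ = _ + X]big1 ?addr0 => [|j /cS->]; last by rewrite scale0r.
rewrite big_imset; last by move=> ? ? _ _; apply: finj.
by apply: eq_bigr => j _; rewrite mxE row_rowsub row_rows_in.
Qed.

End RowSpans.

(** * Lifts as solutions of a homogeneous linear system *)

Section LiftSystem.
Variables (K : numFieldType) (d n : nat) (P : {set {set 'I_d}}) (q : 'rV[K]_n).
Implicit Types (A B : 'M[K]_(d, n)) (T : {set 'I_d}) (v z : 'I_d -> K) (f : {ffun 'I_n -> 'I_d}).

Definition in_line f := [exists l in P, [forall i, f i \in l]].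

Lemma in_lineP f : reflect (exists2 l, l \in P & forall i, f i \in l) (in_line f).
Proof.
by apply: (iffP exists_inP) => -[l lP fl]; exists l => //; apply/forallP.
Qed.

(* The last condition is the linear part in v of det (rowsub f (lift_rows A v q)) = 0, and is
   equivalent to it when det (rowsub f A) = 0, see det_lift_rows; vanishing on a spanning T
   excludes the trivial lifts, which move all rows into another hyperplane. *)
Definition has_lift T A := exists v, [/\ exists e, v e != 0,
  forall e, (e \in T) || (e \notin cover P) -> v e = 0 &
  forall f, in_line f -> \sum_k v (f k) * (q *m \adj (rowsub f A)) 0 k = 0].

Lemma det_lift_rows A z (f : 'I_n -> 'I_d) : \det (rowsub f (lift_rows A z q)) =
  \det (rowsub f A) + \sum_k z (f k) * (q *m \adj (rowsub f A)) 0 k.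
Proof.
have -> : rowsub f (lift_rows A z q) = rowsub f A + (\col_k z (f k)) *m q.
  by apply/matrixP => i j; rewrite !mxE big_ord1 !mxE.
rewrite det_rank1_update; congr (_ + _); rewrite [LHS]mxE.
by apply: eq_bigr => k _; rewrite mulrC mxE.
Qed.

(** Fewer than [n] lifted rows have a common normal [g], and [v] is the pairing of the lifted rows
    with [g]: a multiple of [z] corrected by a trivial lift so as to vanish on [T]. It is nonzero
    because [g] is not normal to the whole lifted block. *)
Lemma has_lift_of_lift T A z : (#|T| < n)%N ->
  (forall f, in_line f -> \det (rowsub f (lift_rows A z q)) = 0) ->
  (forall g, orth (lift_rows A z q) (cover P) g -> g = 0) -> has_lift T A.
Proof.
move=> Tn detB spanB; set B := lift_rows A z q in detB spanB.
have [|g [g0 Tg]] := @subsets_rowdep_orth _ _ _ B T.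
  by move=> T' /subset_leq_card + T'n; rewrite T'n leqNgt Tn.
exists (fun e => if e \in cover P then dot (row e B) g else 0); split.
- apply: contrapT => noe; case/eqP: g0; apply: spanB => e eP.
  by apply/eqP/negP => /negP ge; apply: noe; exists e; rewrite eP.
- by move=> e; case: ifP => // _ /orP[/Tg|].
move=> f fl; have := detB f fl; have [l lP fi] := in_lineP _ fl.
have fE k : f k \in cover P by apply/bigcupP; exists l.
rewrite det_lift_rows => det0.
(* After expansion of [rowsub f B], the adjugate turns this into [dot q g] times the determinant of
   the lifted rows, which is 0. *)
transitivity ((q *m \adj (rowsub f A) *m (rowsub f B *m g^T)) 0 0).
  rewrite [RHS]mxE; apply: eq_bigr => k _; rewrite fE mulrC; congr (_ * _).
  by rewrite /dot !mxE; apply: eq_bigr => j _; rewrite !mxE.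
have -> : rowsub f B = rowsub f A + (\col_k z (f k)) *m q.
  by apply/matrixP => i j; rewrite !mxE big_ord1 !mxE.
set w := (\sum_k _) in det0.
rewrite mulmxA mulmxDr -[q *m \adj _ *m rowsub f A]mulmxA mul_adj_mx mul_mx_scalar mulmxA.
have -> : q *m \adj (rowsub f A) *m (\col_k z (f k)) = w%:M.
  apply/matrixP => i j; rewrite !ord1 !mxE mulr1n; apply: eq_bigr => k _.
  by rewrite mulrC mxE.
by rewrite mul_scalar_mx -scalerDl det0 scale0r mul0mx mxE.
Qed.

(** The system of [has_lift], with solutions [v] as left kernel: one column per tuple and one per
    element, zero where nothing is required. *)
Definition lift_mx T A : 'M[K]_(d, #|{: {ffun 'I_n -> 'I_d}}| + d) :=
  row_mx (\matrix_(e, j) (if in_line (enum_val j)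
      then \sum_(k | enum_val j k == e) (q *m \adj (rowsub (enum_val j) A)) 0 k else 0))
    (diag_mx (\row_e ((e \in T) || (e \notin cover P))%:R)).

Lemma has_liftP T A : has_lift T A <-> ~~ row_free (lift_mx T A).
Proof.
have E (v : 'rV[K]_d) (j : 'I_#|{: {ffun 'I_n -> 'I_d}}|) : in_line (enum_val j) ->
    (v *m (\matrix_(e, j) (if in_line (enum_val j)
      then \sum_(k | enum_val j k == e) (q *m \adj (rowsub (enum_val j) A)) 0 k else 0))) 0 j =
    \sum_k v 0 (enum_val j k) * (q *m \adj (rowsub (enum_val j) A)) 0 k.
  move=> fl; rewrite mxE [RHS](partition_big (enum_val j) xpredT) //=.
  apply: eq_bigr => e _; rewrite mxE fl mulr_sumr.
  by apply: eq_bigr => k /eqP <-.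
split=> [[v [[e ve] vT vf]]|/(row_free0P _)/existsNP[v /not_implyP[v0 /eqP vN]]].
  apply/negP => /row_free0P/(_ (\row_e v e)) v0; have : \row_e v e = 0.
    apply: v0; rewrite mul_mx_row; apply/rowP => j; case: (split_ordP j) => i ->.
      rewrite row_mxEl [RHS]mxE; have [fl|fl] := boolP (in_line (enum_val i)).
        by rewrite E // -[RHS](vf _ fl); apply: eq_bigr => k _; rewrite mxE.
      by rewrite mxE big1 // => a _; rewrite !mxE (negPf fl) mulr0.
    rewrite row_mxEr mul_mx_diag !mxE; have := vT i; case: (_ || _) => [->//|_].
      by rewrite mul0r.
    by rewrite mulr0.
  by move/rowP/(_ e)/eqP; rewrite !mxE (negPf ve).
move: v0; rewrite mul_mx_row => /eqP; rewrite row_mx_eq0 => /andP[/eqP v1 /eqP v2].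
exists (v 0); split.
- by have [e] := rV0Pn _ vN; exists e.
- move=> e eT; have /rowP/(_ e) := v2; rewrite mul_mx_diag !mxE eT mulr1 => ->.
  by [].
- move=> f fl; have /rowP/(_ (enum_rank f)) := v1; rewrite E enum_rankK // => ->.
  by rewrite mxE.
Qed.

Lemma fa_lift_mx X (C : (X -> K) -> Prop) T (M : X -> 'M[K]_(d, n)) : function_algebra C ->
  fa_mx C M -> fa_mx C (fun x => lift_mx T (M x)).
Proof.
move=> CA CM i j; case: (split_ordP j) => j' ->.
  have H : C (fun x => if in_line (enum_val j') then
     \sum_(k | enum_val j' k == i) (q *m \adj (rowsub (enum_val j') (M x))) 0 k else 0).
    case: (in_line _); last exact: (fa_const CA).
    apply: (fa_sum CA) => k _; apply: (fa_mx_mul CA); first exact: fa_mx_const.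
    exact/(fa_adj CA)/(fa_mx_rowsub CA).
  by apply: (fa_ext CA) H => x; rewrite row_mxEl [RHS]mxE.
by apply: (fa_ext CA) (fa_mx_const CA (diag_mx (\row_e ((e \in T) || (e \notin cover P))%:R)) i j')
  => x; rewrite row_mxEr.
Qed.

(** A rank condition written as polynomial equations, so having a lift is a closed condition on
    [A]. *)
Lemma has_lift_det T A : has_lift T A <-> forall R, \det (lift_mx T A *m R) = 0.
Proof.
split=> [/has_liftP nfree R|det0].
  apply/eqP; rewrite -[_ == 0]negbK -unitfE -unitmxE -row_free_unit; apply: contra nfree.
  move=> /row_freeP[B RB]; apply/row_freeP; exists (R *m B); by rewrite mulmxA.
apply/has_liftP/negP => /row_freeP[R RE]; have := det0 R.
by rewrite RE det1 => /eqP; rewrite oner_eq0.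
Qed.

End LiftSystem.

(** * Inclusions between varieties of labelings *)

Section Irredundance.
Variables (K : numFieldType) (d n : nat) (D : {set {set 'I_d}}).
Hypothesis LS : line_system n D.
Local Notation line := {set 'I_d}.
Variables (L1 L2 : finType) (c1 : line -> L1) (c2 : line -> L2).
Hypotheses (sep1 : separated D c1) (sep2 : separated D c2).
Hypothesis V12 : forall A : 'M[K]_(d, n), variety D c1 A -> variety D c2 A.

(** At a good point of V_c1, a common normal of [l] and [l'], given by V_c2, would be proportional
    to two independent normals. *)
Lemma variety_sub_refine l l' : l \in D -> l' \in D -> c2 l = c2 l' -> c1 l = c1 l'.
Proof.
move=> lD lD' c2l; apply/eqP; apply: contraT => c1l.
have [x [[xn0 xnp] xs]] := exists_good K LS sep1.
have [|g [g0 gO]] := @variety_orth K d n D LS L2 c2 (c2 l) (phi D c1 x) _ (V12 (@variety_phi _ _ _ _ _ _ _)).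
  by exists l.
have [q] := dot_neq0 g0; rewrite dotC => gq.
have gl : orth (phi D c1 x) l g := orthS (line_sub_Hset c2 lD) gO.
have gl' : orth (phi D c1 x) l' g by apply: (orthS _ gO); rewrite c2l line_sub_Hset.
have gqN : dot g q != 0 by rewrite gq oner_eq0.
have := spans_parallel (xs l lD) (phi_orth_line LS c1 x lD) gl gqN.
have := spans_parallel (xs l' lD') (phi_orth_line LS c1 x lD') gl' gqN.
rewrite gq !divr1; set a' := dot _ q => hl'; set a := dot _ q => hl.
have hnp : np (normal (c1 l) x) (normal (c1 l') x) by apply: xnp => //; [exists l|exists l'].
have [|a'0 _] := npP _ _ hnp a' (- a).
  by rewrite hl hl' !scalerA mulNr mulrC scaleNr subrr.
by have := np_neq0l (np_sym hnp); rewrite hl' a'0 scale0r eqxx.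
Qed.

Section Split.
Variables (k : L1) (l1 l2 : line).
Hypotheses (D1 : l1 \in D) (D2 : l2 \in D) (c1l1 : c1 l1 = k) (c1l2 : c1 l2 = k).
Hypothesis c2N : c2 l1 != c2 l2.
Local Notation P := (block D c1 k).
Local Notation E := (cover (block D c1 k)).
Variable q : 'rV[K]_n.

Lemma block_line l : l \in P -> l \in D /\ c1 l = k.
Proof. by rewrite inE => /andP[-> /eqP]. Qed.

Lemma line_block l : l \in D -> c1 l = k -> l \in P.
Proof. by move=> lD cl; rewrite inE lD cl eqxx. Qed.

Lemma block_cover l : l \in P -> l \subset E.
Proof. by move=> lP; apply: bigcup_sup. Qed.

(** At a good parameter of [c2] the lines [l1] and [l2] have independent normals, so no hyperplane
    contains the rows of the block and the zero lift feeds [has_lift_of_lift]. Closedness extends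
    this to V_c2. *)
Lemma variety2_has_lift (T : line) (A : 'M[K]_(d, n)) : (#|T| < n)%N -> variety D c2 A ->
  has_lift P q T A.
Proof.
move=> Tn VA; apply/has_lift_det => R.
have FA := mpoly_fun_algebra K d n.
have mf : mpoly_fun (fun B : 'M[K]_(d, n) => \det (lift_mx P q T B *m R)).
  apply: (fa_det FA); apply: (fa_mx_mul FA); last exact: fa_mx_const.
  by apply: (fa_lift_mx _ _ _ FA); apply: mpoly_fun_id.
apply: (variety_closed mf (zopen_good (c := c2) (D := D)) (exists_good K LS sep2) _ VA).
move=> x [[xn0 xnp] xs]; move: R {mf}; apply/has_lift_det.
have lift0 : lift_rows (phi D c2 x) (fun=> 0) q = phi D c2 x.
  by apply/row_matrixP => e; rewrite row_lift_rows scale0r addr0.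
apply: (has_lift_of_lift (z := fun=> 0)) => //; rewrite lift0.
  move=> f /in_lineP[l lP fl]; have [lD _] := block_line lP.
  apply: (orth_det _ _ fl); last exact: phi_orth_line.
  by apply: xn0; exists l.
move=> g gE; have gl l : l \in P -> orth (phi D c2 x) l g.
  by move=> lP; apply: orthS gE; apply: block_cover.
apply/eqP; apply: contraT => /dot_neq0[r]; rewrite dotC => gr.
have grN : dot g r != 0 by rewrite gr oner_eq0.
have hnp : np (normal (c2 l1) x) (normal (c2 l2) x) by apply: xnp => //; [exists l1|exists l2].
have := spans_parallel (xs l1 D1) (phi_orth_line LS c2 x D1) (gl l1 (line_block D1 c1l1)) grN.
have := spans_parallel (xs l2 D2) (phi_orth_line LS c2 x D2) (gl l2 (line_block D2 c1l2)) grN.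
rewrite gr !divr1; set a' := dot _ r => hl'; set a := dot _ r => hl.
have [|a'0 _] := npP _ _ hnp a' (- a).
  by rewrite hl hl' !scalerA mulNr mulrC scaleNr subrr.
by have := np_neq0l (np_sym hnp); rewrite hl' a'0 scale0r eqxx.
Qed.

(* The rows of phi on the block, freed from the hyperplanes of the other labels. *)
Definition free_rows (x : param K d n L1) : 'M[K]_(d, n) :=
  \matrix_e psi (normal k x) (par e ord0 x) (par e (lift ord0 ord0) x).

Lemma free_rows_orth x S : orth (free_rows x) S (normal k x).
Proof. by move=> e _; rewrite rowK dot_psi. Qed.

Lemma free_rows_phi x e : labels D c1 e = [:: k] -> row e (free_rows x) = row e (phi D c1 x).
Proof. by move=> ek; rewrite !rowK /pvec ek. Qed.

Lemma line_poly_free_rows : fa_mx (@line_poly K (param K d n L1)) free_rows.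
Proof.
have CA := param_algebra K d n L1.
have H e : fa_mx (@line_poly K (param K d n L1))
    (fun x => psi (normal k x) (par e ord0 x) (par e (lift ord0 ord0) x)).
  by apply: (fa_psi CA); apply: line_poly_coord.
by move=> e j; apply: (fa_ext CA) (H e 0 j) => x; rewrite [RHS]mxE.
Qed.

Lemma free_rows_surj (B : 'M[K]_(d, n)) h (S : line) : h != 0 -> orth B S h ->
  exists x, normal k x = h /\ forall e, e \in S -> row e (free_rows x) = row e B.
Proof.
move=> h0 SB; have [a ah] := dot_neq0 h0.
exists [ffun i => match i with
  | inl _ => h | inr (e, j) => if j == ord0 then a else row e B end].
rewrite /normal ffunE; split=> // e eS.
by rewrite rowK /normal /par !ffunE /= psi_id // SB.
Qed.

(** A lift [v] of [phi D c1 x] is given on each line by a linear form [g l], and the same forms lift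
    the free rows. They agree at an element on two lines of the block: tameness leaves it the single
    label [k], so its free row is its row in [phi D c1 x]. *)
Lemma free_rows_has_lift (T : line) x : (#|T| < n)%N -> good D c1 x -> dot (normal k x) q != 0 ->
  (forall l, l \in P -> spans (free_rows x) l) -> has_lift P q T (free_rows x).
Proof.
move=> Tn [[xn0 xnp] xs] hq fs; set G := phi D c1 x in xs; set h := normal k x in hq.
have Gh l : l \in P -> orth G l h.
  by move=> /block_line[lD cl]; rewrite /h -cl; apply: phi_orth_line.
have h0 : h != 0 by apply: xn0; exists l1.
have [T1 [T1l T1n indT1]] := xs l1 D1.
have l1P := line_block D1 c1l1.
(* Here [v] vanishes on [T1], which spans the hyperplane of the block in [G], instead of on [T]:
   this excludes the trivial lifts of [G]. *)
have [|v [[e0 ve0] vT vf]] := @variety2_has_lift T1 G _ (V12 (@variety_phi _ _ _ _ _ _ _)).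
  by rewrite -T1n.
have /choice[g gP] : forall l, exists g : 'rV[K]_n, l \in P ->
    dot g q = 1 /\ forall e, e \in l -> dot (row e G) g = - v e.
  move=> l; have [lP|_] := boolP (l \in P); last by exists 0.
  have [lD _] := block_line lP.
  have [|g gP] := @lift_normal _ _ _ G v q h l (xs l lD) (Gh l lP) hq; last by exists g.
  apply: det_orth => f fl.
  have -> : \det (rowsub f (lift_rows G v q)) = \det (rowsub (finfun f) (lift_rows G v q)).
    by congr (\det _); apply/matrixP => i j; rewrite !mxE ffunE.
  have ffl : in_line P (finfun f) by apply/in_lineP; exists l => // i; rewrite ffunE.
  rewrite det_lift_rows (vf _ ffl) addr0; apply: (orth_det h0 (Gh l lP)) => i.
  by rewrite ffunE.
have /choice[le leP] : forall e, exists l, e \in E -> l \in P /\ e \in l.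
  move=> e; have [/bigcupP[l lP el]|_] := boolP (e \in E); first by exists l.
  by exists set0.
pose z e := - dot (row e (free_rows x)) (g (le e)).
have zE l e : l \in P -> e \in l -> dot (row e (free_rows x)) (g l) = - z e.
  move=> lP el; have eE : e \in E by apply: (subsetP (block_cover lP)).
  have [leE ele] := leP e eE; rewrite /z opprK.
  have [->//|lle] := eqVneq (le e) l.
  have [lD cl] := block_line lP; have [leD cle] := block_line leE.
  have ek : labels D c1 e = [:: k].
    have only k' : k' \in labels D c1 e -> k' = k.
      case/labelsP => l' [lD' el' <-].
      by case/or3P: (tame_lines LS leD lD lD' ele el el') lle => /eqP ll'; rewrite -?ll' ?eqxx.
    have ke : k \in labels D c1 e by rewrite -cl labels_line.
    have := only; move: ke; case: (labels_case LS c1 e) => [//|k1|k1 k2 k12].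
      by rewrite inE => /eqP ->.
    move=> _ H; have k1k : k1 = k by apply: H; rewrite mem_head.
    have k2k : k2 = k by apply: H; rewrite !inE eqxx orbT.
    by rewrite k1k k2k eqxx in k12.
  rewrite free_rows_phi //; have [_ ->//] := gP l lP; by have [_ ->] := gP _ leE.
have zO l : l \in P -> orth (lift_rows (free_rows x) z q) l (g l).
  move=> lP e el; have [gq _] := gP l lP.
  by rewrite row_lift_rows dotDl dotZl (dotC q) gq zE // mulr1 addNr.
apply: (has_lift_of_lift (z := z)) => //.
  move=> f /in_lineP[l lP fl]; apply: (orth_det _ (zO l lP) fl).
  have [gq _] := gP l lP.
  by apply: contra_eq_neq gq => ->; rewrite dot0l eq_sym oner_eq0.
move=> g0 g0O; apply/eqP; apply: contraT => g0N.
have eP l e : l \in P -> e \in l -> e \in E by move=> lP; apply: subsetP; apply: block_cover.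
have hspan l g' : l \in P -> orth (free_rows x) l g' -> dot g' q = 0 -> g' = 0.
  move=> lP lg' g'q; rewrite (spans_parallel (fs l lP) lg' (@free_rows_orth x l) hq) g'q.
  by rewrite mul0r scale0r.
have g0q : dot g0 q != 0.
  apply: contraNneq g0N => g0q; apply/eqP/(hspan l1) => // e el.
  by have := g0O e (eP _ _ l1P el); rewrite row_lift_rows dotDl dotZl (dotC q) g0q mulr0 addr0.
pose g1 := (dot g0 q)^-1 *: g0.
have g1q : dot g1 q = 1 by rewrite dotZl mulVf.
(* A normal of the whole lifted block would scale to every [g l]. Then [v] would come from one
   linear form, a multiple of [h] because [v] vanishes on [T1], and would be 0 on the block. *)
have g1E l : l \in P -> g1 = g l.
  move=> lP; have [gq _] := gP l lP; apply/eqP; rewrite -subr_eq0; apply/eqP/(hspan l) => //.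
    move=> e el; rewrite dotBr zE // opprK.
    have := g0O e (eP _ _ lP el); rewrite row_lift_rows dotDl dotZl (dotC q) => /eqP.
    rewrite addr_eq0 => /eqP eg0.
    by rewrite dotZr eg0 mulrN mulrCA mulVf // mulr1 addNr.
  by rewrite dotBl g1q gq subrr.
have g1v e : e \in E -> dot (row e G) g1 = - v e.
  by case/bigcupP => l lP el; rewrite (g1E l lP); have [_ ->] := gP l lP.
have g1h : g1 = (dot g1 q / dot h q) *: h.
  apply: (orth_parallel indT1) => //; first by rewrite T1n.
    move=> e eT; rewrite g1v; last exact/(eP l1)/(subsetP T1l).
    by rewrite vT ?eT // oppr0.
  exact/(orthS T1l)/Gh.
have e0E : e0 \in E by apply: contraNT ve0 => e0E; rewrite vT // e0E orbT.
case/negP: ve0; rewrite -oppr_eq0 -g1v // g1h dotZr.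
have [l lP el] := bigcupP e0E.
by rewrite (Gh l lP) // mulr0.
Qed.

Lemma all_has_lift (T : line) x : (#|T| < n)%N ->
  (exists x : param K d n L1, dot (normal k x) q != 0) -> has_lift P q T (free_rows x).
Proof.
move=> Tn neq; apply/has_lift_det => R; have CA := param_algebra K d n L1.
have fs : forall l, l \in P -> exists x, spans (free_rows x) l.
  move=> l lP; have [lD cl] := block_line lP; have [y [[yn0 _] ys]] := exists_good K LS sep1.
  have [||x' [_ x'E]] := @free_rows_surj (phi D c1 y) (normal k y) l.
  - by apply: yn0; exists l.
  - by rewrite -cl; apply: phi_orth_line.
  - by exists x'; apply: (eq_rows_spans (fun e el => esym (x'E e el))); apply: ys.
have oS l : zopen (fun x => spans (free_rows x) l).
  exact/zopen_spans_mx/line_poly_free_rows.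
have [y yP] := zopen_meet_forall (fun l (_ : l \in P) => oS l) fs.
have oSS : zopen (fun x => forall l, l \in P -> spans (free_rows x) l).
  by apply: zopen_forall => l _.
have oq : zopen (fun x : param K d n L1 => dot (normal k x) q != 0).
  apply: zopen_neq0; apply: (fa_dot CA); first exact: line_poly_coord.
  exact: fa_mx_const.
have [w wq] := neq; have [w' w'g] := exists_good K LS sep1.
have [y1 y1P] := zopen_meet oSS oq yP wq.
have o1 := zopenI oSS oq; have og := zopen_good (c := c1) (D := D) (K := K) (n := n).
apply: (line_poly_eq0 (f := fun x => \det (lift_mx P q T (free_rows x) *m R)) _ (zopenI o1 og)).
- apply: (fa_det CA); apply: (fa_mx_mul CA); last exact: fa_mx_const.
  by apply: (fa_lift_mx _ _ _ CA); apply: line_poly_free_rows.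
- exact: (zopen_meet o1 og y1P w'g).
by move=> x' [[x's x'q] x'g]; move: R; apply/has_lift_det; apply: free_rows_has_lift.
Qed.

End Split.

(** The given vectors are free rows of some parameter, so they have a lift [v]. Their determinants
    on each line vanish, so the linearized condition is exact; as [v] is nonzero but vanishes on a
    spanning [T], the lifted vectors leave every hyperplane. *)
Lemma split_liftable k l1 l2 : l1 \in D -> l2 \in D -> c1 l1 = k -> c1 l2 = k -> c2 l1 != c2 l2 ->
  liftable K n (cover (block D c1 k)) (dep_of (ML_circuits (block D c1 k) n)).
Proof.
move=> D1 D2 c1l1 c1l2 c2N A H q hypH AH qH; set P := block D c1 k; set E := cover P in AH *.
have rE : (\rank (rows_in A E)).+1 = n by rewrite (eqmxP AH); apply/eqP.
have n0 : (0 < n)%N by rewrite -rE.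
have [T [TE Tn indT]] := rank_spans rE.
have Tlt : (#|T| < n)%N by rewrite -Tn.
have [h [h0 Eh]] : exists h, h != 0 /\ orth A E h.
  apply: subsets_rowdep_orth => S SE Sn; apply: contrapT => /not_rowdep/eqP rS.
  have := mxrankS (subrows_sub A SE); rewrite rS Sn -{1}rE ltnn //.
have hq : dot h q != 0.
  apply: contraNneq qH => hq; rewrite -(eqmxP AH).
  have /mulmx0_rank_max : col_mx (rows_in A E) q *m h^T = 0.
    rewrite mul_col_mx rows_in_orth //; suff -> : q *m h^T = 0 by rewrite col_mx0.
    by apply/matrixP => i j; rewrite !ord1 [RHS]mxE -[LHS]/(dot q h) dotC.
  rewrite mxrank_tr rank_rV h0 [(_ + true)%N]addn1 => rlt.
  have rle : (\rank (rows_in A E + q)%MS <= \rank (rows_in A E))%N.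
    by rewrite -ltnS rE addsmxE.
  have := mxrank_leqif_sup (addsmxSl (rows_in A E) q) => /leqifP.
  case: ifP => [|_]; first by rewrite addsmx_sub => /andP[].
  by rewrite ltnNge rle.
have [x0 [x0h x0E]] := free_rows_surj k h0 Eh.
have [|v [[e0 ve0] vT vf]] := @all_has_lift k l1 l2 D1 D2 c1l1 c1l2 c2N q T x0 Tlt.
  by exists x0; rewrite x0h.
have lE l : l \in P -> l \subset E by move=> lP; apply: bigcup_sup.
have vdet l (f : 'I_n -> 'I_d) : l \in P -> (forall i, f i \in l) ->
    \det (rowsub f (lift_rows A v q)) = 0.
  move=> lP fl; have ffl : in_line P (finfun f) by apply/in_lineP; exists l => // i; rewrite ffunE.
  have := vf _ ffl.
  have -> : rowsub (finfun f) (free_rows k x0) = rowsub f A.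
    apply/row_matrixP => i; rewrite !row_rowsub ffunE x0E //.
    exact: (subsetP (lE l lP)).
  rewrite det_lift_rows (orth_det h0 (orthS (lE l lP) Eh) fl) add0r => s0.
  by rewrite -[RHS]s0; apply: eq_bigr => i _; rewrite ffunE.
exists v; split.
  move=> S SE /exists_inP[C]; rewrite inE => /andP[_ CP] CS; apply: (rowdepS CS).
  case/orP: CP => [/andP[/eqP Cn /exists_inP[l lP Cl]]|/andP[/eqP Cn _]]; last first.
    by apply: card_rowdep; rewrite Cn.
  have [g [g0 gl]] := det_orth (vdet l ^~ lP).
  by apply: (orth_rowdep g0 (orthS Cl gl)); rewrite Cn.
case=> H' hypH' rowsH'.
have [g [g0 gH']] : exists g : 'rV[K]_n, g != 0 /\ H' *m g^T = 0.
  have : ~~ row_free H'^T.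
    have /eqP rH' := hypH'; rewrite /row_free mxrank_tr neq_ltn.
    by apply/orP; left; rewrite -ltnS rH'.
  move/(row_free0P _)/existsNP => [g /not_implyP[gH /eqP g0]]; exists g; split=> //.
  by apply: trmx_inj; rewrite trmx_mul trmxK gH trmx0.
have gE : orth (lift_rows A v q) E g.
  by move=> e /rowsH' /submxP[B eB]; rewrite /dot eB -mulmxA gH' mulmx0 mxE.
have gh : g = (dot g q / dot h q) *: h.
  apply: (orth_parallel indT) => //; [by rewrite Tn| |exact: orthS TE Eh].
  move=> e eT; have := gE e (subsetP TE e eT).
  by rewrite row_lift_rows vT ?eT // scale0r addr0.
have gq : dot g q != 0 by apply: contraNneq g0 => gq; rewrite gh gq mul0r scale0r.
have e0E : e0 \in E by apply: contraNT ve0 => e0E; rewrite vT // e0E orbT.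
have := gE e0 e0E; rewrite row_lift_rows dotDl dotZl {1}gh dotZr Eh // mulr0 add0r (dotC q).
by move/eqP; rewrite mulf_eq0 (negPf ve0) (negPf gq).
Qed.

End Irredundance.

Section PartitionBlocks.
Variables (d : nat) (D : {set {set 'I_d}}).
Implicit Types (Q : {set {set {set 'I_d}}}).

Lemma block_pblock Q k : partition Q D -> k \in Q -> block D (pblock Q) k = k.
Proof.
move=> QD kQ; apply/setP => l; rewrite inE; apply/andP/idP => [[lD /eqP <-]|lk].
  by rewrite mem_pblock (cover_partition QD).
by rewrite (block_sub QD kQ lk) (pblock_label QD kQ lk).
Qed.

Lemma partition_kernel_sub Q1 Q2 : partition Q1 D -> partition Q2 D ->
  (forall l l', l \in D -> l' \in D -> (pblock Q1 l = pblock Q1 l') <-> (pblock Q2 l = pblock Q2 l')) ->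
  Q1 \subset Q2.
Proof.
move=> P1 P2 ker; apply/subsetP => k kQ.
have [l lk] : exists l, l \in k by apply/set0Pn; apply: contraTneq kQ => ->; case/and3P: P1.
have lD := block_sub P1 kQ lk.
have l2 : pblock Q2 l \in Q2 by apply: pblock_mem; rewrite (cover_partition P2).
suff -> : k = pblock Q2 l by [].
rewrite -(block_pblock P1 kQ) -(block_pblock P2 l2) -(pblock_label P1 kQ lk).
apply/setP => l'; rewrite !inE; case: (boolP (l' \in D)) => //= lD'.
by apply/eqP/eqP => /(ker _ _ lD' lD).
Qed.

End PartitionBlocks.

Lemma tame_paving_decomposition (K : numFieldType) (d n : nat) (I : {set {set 'I_d}}) :
  is_matroid I -> paving I n -> tame I n ->
  [/\ (forall A : 'M[K]_(d, n),
         circuit_variety (fun S => S \notin I) A <->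
         exists2 Q, nice_partition K n I Q & matroid_variety (dep_of (MQ_circuits Q n)) A),
      (forall Q, nice_partition K n I Q ->
         irreducible (matroid_variety (K := K) (n := n) (dep_of (MQ_circuits Q n)))) &
      (forall Q1 Q2, nice_partition K n I Q1 -> nice_partition K n I Q2 -> Q1 != Q2 ->
         ~ (forall A : 'M[K]_(d, n),
              matroid_variety (dep_of (MQ_circuits Q1 n)) A ->
              matroid_variety (dep_of (MQ_circuits Q2 n)) A))].
Proof.
move=> MI PI TI; have LS := paving_line_system MI PI TI.
have niceE Q (A : 'M[K]_(d, n)) : nice_partition K n I Q ->
    matroid_variety (dep_of (MQ_circuits Q n)) A <-> variety (dep_hyps I n) (pblock Q) A.
  by case=> QD _ Q2; apply: (matroid_varietyE LS QD); apply: separated_nice.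
split.
- move=> A; rewrite circuit_varietyP //; split=> [hA|[Q nQ]].
    have [c0 c0A] := orth_lines_variety LS hA.
    have [c [cA sep nl]] := maximal_labeling LS c0A.
    have [Q [QD Q1 Q2 QV]] := nice_of_labeling LS sep nl.
    by exists Q; [split|apply/niceE; [split|apply: QV]].
  move/(niceE _ _ nQ) => QA l lD; have lu : used (dep_hyps I n) (pblock Q) (pblock Q l) by exists l.
  have [g [g0 gO]] := variety_orth LS lu QA; exists g; split=> //.
  by apply: (orthS _ gO); apply: line_sub_Hset.
- move=> Q nQ; have -> : matroid_variety (K := K) (n := n) (dep_of (MQ_circuits Q n)) =
      variety (dep_hyps I n) (pblock Q).
    by apply: funext => A; apply/propext/niceE.
  exact: variety_irreducible.
- move=> Q1 Q2 n1 n2 Q12 sub; case/eqP: Q12.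
  have V12 (A : 'M[K]_(d, n)) : variety (dep_hyps I n) (pblock Q1) A ->
      variety (dep_hyps I n) (pblock Q2) A.
    by move=> /(niceE _ _ n1)/sub/(niceE _ _ n2).
  case: n1 n2 => P1 nl1 s1 [P2 _ s2].
  have sep1 := separated_nice P1 s1; have sep2 := separated_nice P2 s2.
  have ker l l' : l \in dep_hyps I n -> l' \in dep_hyps I n ->
      (pblock Q1 l = pblock Q1 l') <-> (pblock Q2 l = pblock Q2 l').
    move=> lD lD'; split=> [l12|]; last exact: (variety_sub_refine LS sep1 V12 lD lD').
    (* A block of [Q1] split by [Q2] has at least two lines and is liftable by [split_liftable],
       although [Q1] is nice. *)
    apply/eqP; apply: contraT => l21.
    have kQ : pblock Q1 l \in Q1 by apply: pblock_mem; rewrite (cover_partition P1).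
    have := split_liftable LS sep1 sep2 V12 lD lD' erefl (esym l12) l21.
    rewrite (block_pblock P1 kQ) => /nl1; case=> //; apply/card_gt1P; exists l, l'; split.
    + by rewrite mem_pblock (cover_partition P1).
    + by rewrite l12 mem_pblock (cover_partition P1).
    + by apply: contraNneq l21 => ->.
  apply/eqP; rewrite eqEsubset (partition_kernel_sub P1 P2 ker).
  by apply: (partition_kernel_sub P2 P1) => l l' lD lD'; apply: iff_sym; apply: ker.
Qed.

Theorem theorem4p6 (R : realType) (d n : nat) (I : {set {set 'I_d}}) :
  is_matroid I -> has_rank I n -> paving I n -> tame I n ->
  [/\ (forall A : 'M[R[i]]_(d, n),
         circuit_variety (fun S => S \notin I) A <->
         exists2 Q, nice_partition R[i] n I Q &
                    matroid_variety (dep_of (MQ_circuits Q n)) A),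
      (forall Q, nice_partition R[i] n I Q ->
         irreducible (matroid_variety (K := R[i]) (n := n) (dep_of (MQ_circuits Q n)))) &
      (forall Q1 Q2, nice_partition R[i] n I Q1 -> nice_partition R[i] n I Q2 ->
         Q1 != Q2 ->
         ~ (forall A : 'M[R[i]]_(d, n),
              matroid_variety (dep_of (MQ_circuits Q1 n)) A ->
              matroid_variety (dep_of (MQ_circuits Q2 n)) A))].
Proof. by move=> MI _ PI TI; apply: tame_paving_decomposition. Qed.
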